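(* Let $F$ be a free group of finite rank with a fixed basis $A$. The subgroup distance problem in $F$ is solvable in polynomial time. That is, there is an algorithm which, given two finitely generated subgroups $H,K\le F$ by finite lists of generators written as words in $A\cup A^{-1}$, finds elements $h\in H$ and $k\in K$, not both trivial, such that $d_A(h,k)$ is minimal among all pairs in $H\times K$ that are not both trivial, in time polynomial in the total length of the input words.
   Context: For $f\in F$, $|f|$ is the length of the reduced word in $A\cup A^{-1}$ representing $f$, and $d_A(f,f')=|f^{-1}f'|$ is the word metric. Subgroup distance problem in a group $G$ with fixed finite generating set: given two finitely generated subgroups $H$ and $K$ of $G$, find the distance between them, i.e., find $h\in H$ and $k\in K$, not both trivial, with a shortest distance apart. (If $H$ and $K$ are both trivial there is no such pair, and the algorithm reports this.) *)

(* Defs.v *)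
From HB Require Import structures.
From mathcomp Require Import all_boot all_algebra.

Set Implicit Arguments.
Unset Strict Implicit.
Unset Printing Implicit Defensive.

Import GRing.Theory.

Section FreeGroup.
Variable A : finType.

(* [(a, false)] is the letter a and [(a, true)] the letter a^-1. *)
Definition letter := (A * bool)%type.
Definition word := seq letter.

Definition linv (x : letter) : letter := (x.1, ~~ x.2).

Definition reduced (w : word) : bool := sorted (fun x y => y != linv x) w.

Definition cons_red (x : letter) (w : word) : word :=
  if w is y :: w' then if y == linv x then w' else x :: w else [:: x].

Definition reduce (w : word) : word := foldr cons_red [::] w.

Definition winv (w : word) : word := rev (map linv w).

Lemma linvK : involutive linv.
Proof. by case=> a b; rewrite /linv /= negbK. Qed.

Lemma cons_red_reduced x w : reduced w -> reduced (cons_red x w).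
Proof.
case: w => [|y w] //=; case: ifPn => [_ | yx] Hw; first exact: (path_sorted Hw).
by rewrite /= yx.
Qed.

Lemma reduce_reduced w : reduced (reduce w).
Proof. by elim: w => //= x w; apply: cons_red_reduced. Qed.

Lemma reduce_id w : reduced w -> reduce w = w.
Proof.
elim: w => //= x w IH Hxw; rewrite IH; last exact: (path_sorted Hxw).
by case: w Hxw {IH} => //= y w /andP[/negbTE-> _].
Qed.

Lemma cons_redK x w : reduced w -> cons_red x (cons_red (linv x) w) = w.
Proof.
case: w => [|y w] /=; first by rewrite eqxx.
rewrite linvK; case: eqP => [-> | _]; last by rewrite /= eqxx.
by case: w => //= z w /andP[/negbTE-> _].
Qed.

Lemma reduce_cat_r u v : reduce (u ++ reduce v) = reduce (u ++ v).
Proof.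
by rewrite /reduce !foldr_cat -!/(reduce _) (reduce_id (reduce_reduced v)).
Qed.

Lemma reduce_cons_red x u v :
  reduce (cons_red x u ++ v) = cons_red x (reduce (u ++ v)).
Proof.
case: u => [|y u] //=; case: eqP => [-> | _] //=.
by rewrite cons_redK // reduce_reduced.
Qed.

Lemma reduce_cat_l u v : reduce (reduce u ++ v) = reduce (u ++ v).
Proof. by elim: u => //= x u IH; rewrite reduce_cons_red IH. Qed.

Lemma winvK : involutive winv.
Proof. by move=> w; rewrite /winv map_rev revK (mapK linvK). Qed.

Lemma winv_cat u v : winv (u ++ v) = winv v ++ winv u.
Proof. by rewrite /winv map_cat rev_cat. Qed.

Lemma reduce_winvl w : reduce (winv w ++ w) = [::].
Proof.
elim: w => // x w IH; rewrite -cat1s winv_cat -catA -reduce_cat_r /=.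
rewrite -[X in cons_red _ (cons_red X _)]linvK cons_redK ?reduce_reduced //.
by rewrite reduce_cat_r.
Qed.

Lemma reduce_winvr w : reduce (w ++ winv w) = [::].
Proof. by rewrite -{1}(winvK w) reduce_winvl. Qed.

Record freegroup := FreeGroup {
  fgword :> word;
  fgword_reduced : reduced fgword }.

HB.instance Definition _ := [isSub for fgword].
HB.instance Definition _ := [Choice of freegroup by <:].

(* The element of the free group represented by a (not necessarily reduced)
   word. *)
Definition welt (w : word) : freegroup := FreeGroup (reduce_reduced w).

Definition fg_one : freegroup := welt [::].
Definition fg_mul (f g : freegroup) : freegroup := welt (fgword f ++ fgword g).
Definition fg_inv (f : freegroup) : freegroup := welt (winv (fgword f)).

Lemma fg_mulA : associative fg_mul.
Proof.
by move=> f g h; apply: val_inj; rewrite /= reduce_cat_r reduce_cat_l catA.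
Qed.

Lemma fg_mul1g : left_id fg_one fg_mul.
Proof. by move=> f; apply: val_inj; rewrite /= reduce_id // fgword_reduced. Qed.

Lemma fg_mulg1 : right_id fg_one fg_mul.
Proof.
by move=> f; apply: val_inj; rewrite /= cats0 reduce_id // fgword_reduced.
Qed.

Lemma fg_mulVg : left_inverse fg_one fg_inv fg_mul.
Proof. by move=> f; apply: val_inj; rewrite /= reduce_cat_l reduce_winvl. Qed.

Lemma fg_mulgV : right_inverse fg_one fg_inv fg_mul.
Proof. by move=> f; apply: val_inj; rewrite /= reduce_cat_r reduce_winvr. Qed.

HB.instance Definition _ :=
  isGroup.Build freegroup fg_mulA fg_mul1g fg_mulg1 fg_mulVg fg_mulgV.

Definition fglen (f : freegroup) : nat := size (fgword f).

Definition fgdist (f g : freegroup) : nat := fglen (f^-1 * g)%g.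

End FreeGroup.

Inductive subgroup_gen (G : groupType) (S : seq G) : G -> Prop :=
| sg_gen g : g \in S -> subgroup_gen S g
| sg_one : subgroup_gen S 1%g
| sg_mul g h : subgroup_gen S g -> subgroup_gen S h -> subgroup_gen S (g * h)%g
| sg_inv g : subgroup_gen S g -> subgroup_gen S g^-1%g.

Section DistanceProblem.
Variable A : finType.

Definition wsubgroup (ws : seq (word A)) : freegroup A -> Prop :=
  subgroup_gen (map (@welt A) ws).

Definition nontrivial_pair (H K : freegroup A -> Prop) (h k : freegroup A) :=
  [/\ H h, K k & ~ (h = 1%g /\ k = 1%g)].

Definition closest_pair (H K : freegroup A -> Prop) (h k : freegroup A) :=
  nontrivial_pair H K h k /\
  forall h' k', nontrivial_pair H K h' k' -> fgdist h k <= fgdist h' k'.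

(* The output [None] is the report that H and K are both trivial. *)
Definition subgroup_distance
    (I : seq (word A) * seq (word A)) (O : option (word A * word A)) : Prop :=
  let H := wsubgroup I.1 in
  let K := wsubgroup I.2 in
  match O with
  | None => (forall h, H h -> h = 1%g) /\ (forall k, K k -> k = 1%g)
  | Some (u, v) => closest_pair H K (welt u) (welt v)
  end.

(* Each word counts for its length plus one end marker: otherwise a list of
   arbitrarily many empty words would be an input of size 0. *)
Definition input_size (I : seq (word A) * seq (word A)) : nat :=
  sumn [seq (size w).+1 | w <- I.1] + sumn [seq (size w).+1 | w <- I.2].

End DistanceProblem.

(* Programs of Jones's language WHILE over binary trees.  Every evaluation of a
   (sub)expression is charged the size of the tree it produces, as if all trees
   were copied and no substructure were shared.  Programs and multitape Turing
   machines therefore simulate each other with polynomial overhead. *)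

Inductive tree := Leaf | Node of tree & tree.

Fixpoint tsize (t : tree) : nat :=
  if t is Node t1 t2 then (tsize t1 + tsize t2).+1 else 1.

Inductive expr :=
| Var of nat
| ENil
| ECons of expr & expr
| EHd of expr
| ETl of expr.

Inductive cmd :=
| Assign of nat & expr
| Seq of cmd & cmd
| If of expr & cmd & cmd
| While of expr & cmd.

Definition store := nat -> tree.

Fixpoint eval (s : store) (e : expr) : tree :=
  match e with
  | Var x => s x
  | ENil => Leaf
  | ECons e1 e2 => Node (eval s e1) (eval s e2)
  | EHd e1 => if eval s e1 is Node t _ then t else Leaf
  | ETl e1 => if eval s e1 is Node _ t then t else Leaf
  end.

Fixpoint ecost (s : store) (e : expr) : nat :=
  tsize (eval s e) +
  match e with
  | Var _ | ENil => 0
  | ECons e1 e2 => ecost s e1 + ecost s e2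
  | EHd e1 | ETl e1 => ecost s e1
  end.

Definition upd (s : store) (x : nat) (t : tree) : store :=
  fun y => if y == x then t else s y.

(* [exec c s t s']: started in store [s], the command [c] halts in store [s']
   after time [t].  A test succeeds on every tree other than [Leaf]. *)
Inductive exec : cmd -> store -> nat -> store -> Prop :=
| ExAssign x e s :
    exec (Assign x e) s (ecost s e).+1 (upd s x (eval s e))
| ExSeq c1 c2 s1 s2 s3 t1 t2 :
    exec c1 s1 t1 s2 -> exec c2 s2 t2 s3 ->
    exec (Seq c1 c2) s1 (t1 + t2).+1 s3
| ExIfTrue e c1 c2 s s' t :
    eval s e <> Leaf -> exec c1 s t s' ->
    exec (If e c1 c2) s (ecost s e + t).+1 s'
| ExIfFalse e c1 c2 s s' t :
    eval s e = Leaf -> exec c2 s t s' ->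
    exec (If e c1 c2) s (ecost s e + t).+1 s'
| ExWhileTrue e c s1 s2 s3 t1 t2 :
    eval s1 e <> Leaf -> exec c s1 t1 s2 -> exec (While e c) s2 t2 s3 ->
    exec (While e c) s1 (ecost s1 e + t1 + t2).+1 s3
| ExWhileFalse e c s :
    eval s e = Leaf -> exec (While e c) s (ecost s e).+1 s.

(* Input and output are passed in variable 0. *)
Definition init_store (t : tree) : store := upd (fun=> Leaf) 0 t.

Definition polytime_solvable (I O : Type) (encI : I -> tree) (encO : O -> tree)
    (isize : I -> nat) (R : I -> O -> Prop) : Prop :=
  exists (c : cmd) (p : {poly nat}), forall i : I,
    exists (o : O) (t : nat) (s : store),
      [/\ exec c (init_store (encI i)) t s, s 0 = encO o, R i o
        & t <= (p.[isize i])%R].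

Section Encoding.
Variable A : finType.

Definition enc_bool (b : bool) : tree := if b then Node Leaf Leaf else Leaf.

Definition enc_nat (n : nat) : tree := iter n (Node Leaf) Leaf.

Definition enc_seq (T : Type) (enc : T -> tree) (s : seq T) : tree :=
  foldr (fun x t => Node (enc x) t) Leaf s.

Definition enc_letter (x : letter A) : tree :=
  Node (enc_nat (enum_rank x.1)) (enc_bool x.2).

Definition enc_word : word A -> tree := enc_seq enc_letter.

Definition enc_input (I : seq (word A) * seq (word A)) : tree :=
  Node (enc_seq enc_word I.1) (enc_seq enc_word I.2).

Definition enc_output (O : option (word A * word A)) : tree :=
  if O is Some (u, v) then Node (enc_word u) (enc_word v) else Leaf.

End Encoding.

(* Main.v *)
(* Left cosets g H are represented by reduced words; it suffices to use the
   suffixes of the generators and their one-letter extensions, and on these the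
   relation a^-1 b \in H is a congruence closure (Stallings foldings), computed by
   saturation.  Reading letters from right to left between suffixes modulo this
   relation yields an automaton accepting exactly the reduced words of H, and
   likewise for K.

   Writing h = c h' and k = c k' with c the longest common prefix gives
   d(h, k) = |h'| + |k'|, while d(h, k) <= |h'| + |k'| for any common prefix c.
   Hence a closest pair is a lightest walk in a product of the two automata
   which first reads h' and k' separately, at cost 1 per letter, and then c in
   both automata at once, for free; as only reduced words are read, the pair is
   not trivial as soon as one of the words is nonempty.  Bellman-Ford iteration
   finds such a walk, each table entry carrying the words read so far. *)
Require Import Defs.
From mathcomp Require Import all_boot all_algebra zify.

Set Implicit Arguments.
Unset Strict Implicit.
Unset Printing Implicit Defensive.

Local Notation tsize := Defs.tsize.

(** * Programs computing functions on trees *)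

(** Running times are never computed for the whole algorithm. Polynomial-time functions are shown to
    be closed under pairing, case analysis and folds, and the search is written with ordinary list
    functions, so its time bound follows its syntax. The obstacle is the fold, which preserves
    polynomial time only if all accumulators stay small. For saturation they are sublists of a fixed
    list; for the tables of words, every round keeps at most one entry per vertex and lengthens its
    words by a bounded amount.

    No folded graph is ever formed as a quotient: the automaton keeps all suffixes as vertices and
    is nondeterministic, since only its language matters. Its completeness rests on the closure
    rules of the relation. Words labelling loops at the base vertex are closed under concatenation
    and inversion, and invariance of the relation under left multiplication by a letter allows
    cancelling adjacent inverse letters in a path. *)

Definition polybounded (f : nat -> nat) := exists k, forall n, f n <= (n + 2) ^ k.

Lemma leq_expl2 n k l : k <= l -> (n + 2) ^ k <= (n + 2) ^ l.
Proof. by move=> kl; rewrite leq_pexp2l // addn2. Qed.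

Lemma leq_expr2 m n k : m <= n -> (m + 2) ^ k <= (n + 2) ^ k.
Proof. by move=> mn; case: k => // k; rewrite leq_exp2r // leq_add2r. Qed.

Lemma polybounded_const c : polybounded (fun=> c).
Proof.
exists c => n; apply: leq_trans (ltnW (ltn_expl c (ltnSn 1))) _.
exact: leq_expr2 (leq0n n).
Qed.

Lemma polybounded_id : polybounded id.
Proof. by exists 1 => n; rewrite expn1 leq_addr. Qed.

(** The base [n + 2] is at least 2 even for [n = 0], so one more factor absorbs a sum of two
    powers. *)
Lemma polybounded_add f g :
  polybounded f -> polybounded g -> polybounded (fun n => f n + g n).
Proof.
move=> [k fk] [l gl]; exists (maxn k l).+1 => n; rewrite expnS.
have := leq_trans (fk n) (leq_expl2 n (leq_maxl k l)).
have := leq_trans (gl n) (leq_expl2 n (leq_maxr k l)).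
by nia.
Qed.

Lemma polybounded_mul f g :
  polybounded f -> polybounded g -> polybounded (fun n => f n * g n).
Proof.
by move=> [k fk] [l gl]; exists (k + l) => n; rewrite expnD leq_mul.
Qed.

Lemma polybounded_exp f k : polybounded f -> polybounded (fun n => (f n + 2) ^ k).
Proof.
(* As the base is at least 2, [(n + 2) ^ l + 2 <= (n + 2) ^ l.+2]. *)
move=> [l fl]; exists (l.+2 * k) => n; rewrite expnM.
apply: (@leq_trans (((n + 2) ^ l + 2) ^ k)); first exact: leq_expr2.
case: k => // k; rewrite leq_exp2r // !expnS.
by have : 0 < (n + 2) ^ l; [rewrite expn_gt0 addn2 | nia].
Qed.

Ltac polyb := repeat first
  [ exact: polybounded_id | apply: polybounded_const | apply: polybounded_add
  | apply: polybounded_mul | apply: polybounded_exp ].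

(* The pairs [(a i, b i)] are the graph of a partial function on trees.  The
   program must work in every store, since it may run after another one, and it
   leaves the variables from [n] on to its callers.  The bound also covers the
   size of the output, which makes the class closed under composition. *)
Definition ptree (I : Type) (a b : I -> tree) :=
  exists c n k, 0 < n /\ forall i s, s 0 = a i -> exists t s',
    [/\ exec c s t s', s' 0 = b i, forall y, n <= y -> s' y = s y
      & t + tsize (b i) <= (tsize (a i) + 2) ^ k].

Definition Seqs : cmd -> seq cmd -> cmd := foldl Seq.

Lemma upd_eq s x t : upd s x t x = t.
Proof. by rewrite /upd eqxx. Qed.

Lemma upd_neq s x t y : y != x -> upd s x t y = s y.
Proof. by rewrite /upd => /negbTE->. Qed.

Ltac upds := repeat first [rewrite upd_eq | rewrite upd_neq; [| by lia]].

Lemma tsize_gt0 t : 0 < tsize t. Proof. by case: t. Qed.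

Lemma ptree_assign I (a b : I -> tree) e (f : nat -> nat) : polybounded f ->
  (forall i s, s 0 = a i -> eval s e = b i /\ ecost s e <= f (tsize (a i))) ->
  ptree a b.
Proof.
move=> pf eP.
have [k kP] : polybounded (fun n => f n + f n + 1) by polyb; exact: pf.
exists (Assign 0 e), 1, k; split=> // i s si; have [ev ec] := eP i s si.
exists (ecost s e).+1, (upd s 0 (eval s e)); split.
- exact: ExAssign.
- by upds.
- by move=> y y0; upds.
apply: leq_trans (kP (tsize (a i))).
have : tsize (b i) <= ecost s e by rewrite -ev; case: (e) => *; exact: leq_addr.
lia.
Qed.

Lemma ptree_id I (a : I -> tree) : ptree a a.
Proof.
apply: (@ptree_assign _ _ _ (Var 0) id); first by polyb.
by move=> i s /= ->; rewrite addn0.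
Qed.

Lemma ptree_hd I (a b : I -> tree) : ptree (fun i => Node (a i) (b i)) a.
Proof.
apply: (@ptree_assign _ _ _ (EHd (Var 0)) (fun n => n + n)); first by polyb.
by move=> i s /= -> /=; split=> //; lia.
Qed.

Lemma ptree_tl I (a b : I -> tree) : ptree (fun i => Node (a i) (b i)) b.
Proof.
apply: (@ptree_assign _ _ _ (ETl (Var 0)) (fun n => n + n)); first by polyb.
by move=> i s /= -> /=; split=> //; lia.
Qed.

Fixpoint quote (t : tree) : expr :=
  if t is Node t1 t2 then ECons (quote t1) (quote t2) else ENil.

Lemma eval_quote s t : eval s (quote t) = t.
Proof. by elim: t => //= t1 -> t2 ->. Qed.

Lemma ecost_quote s s' t : ecost s (quote t) = ecost s' (quote t).
Proof. by elim: t => //= t1 -> t2 ->; rewrite !eval_quote. Qed.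

Lemma ptree_const I (a : I -> tree) (t : tree) : ptree a (fun=> t).
Proof.
apply: (@ptree_assign _ _ _ (quote t) (fun=> ecost (fun=> Leaf) (quote t))).
  by polyb.
by move=> i s _; rewrite eval_quote (ecost_quote s (fun=> Leaf)).
Qed.

(** The map [f] matches indices of the two graphs, so a program specified on all inputs of a type
    can follow one that produces only some of them. *)
Lemma ptree_comp I J (a b : I -> tree) (a' b' : J -> tree) (f : I -> J) :
  (forall i, b i = a' (f i)) -> ptree a b -> ptree a' b' ->
  ptree a (fun i => b' (f i)).
Proof.
move=> ba' [c1 [n1 [k1 [n10 H1]]]] [c2 [n2 [k2 [n20 H2]]]].
have [k kP] : polybounded (fun n => (n + 2) ^ k1 + ((n + 2) ^ k1 + 2) ^ k2 + 1).
  by polyb.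
exists (Seq c1 c2), (maxn n1 n2), k; split=> [|i s si]; first lia.
have [t1 [s1 [e1 s10 f1 l1]]] := H1 i s si.
have [|t2 [s2 [e2 s20 f2 l2]]] := H2 (f i) s1; first by rewrite -ba'.
exists (t1 + t2).+1, s2; split=> //.
- exact: ExSeq e1 e2.
- by move=> y ny; rewrite f2 ?f1 //; lia.
apply: leq_trans (kP _); rewrite -ba' in l2.
have : (tsize (b i) + 2) ^ k2 <= ((tsize (a i) + 2) ^ k1 + 2) ^ k2.
  by apply: leq_expr2; lia.
lia.
Qed.

Lemma ptree_ext I (a b a' b' : I -> tree) :
  a =1 a' -> b =1 b' -> ptree a b -> ptree a' b'.
Proof.
move=> aa bb [c [n [k [n0 H]]]]; exists c, n, k; split=> // i s.
by rewrite -aa -bb; apply: H.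
Qed.

Lemma ptree_node I (a b c : I -> tree) :
  ptree a b -> ptree a c -> ptree a (fun i => Node (b i) (c i)).
Proof.
move=> [c1 [n1 [k1 [n10 H1]]]] [c2 [n2 [k2 [n20 H2]]]].
(* Both programs preserve the variables from [m] on, so [m] can hold the input and [m.+1] the first
   result while they run. *)
set m := maxn n1 n2; have [m0 [m1 m2]] : 0 < m /\ n1 <= m /\ n2 <= m by lia.
have [k kP] : polybounded (fun n => n * 5 + (n + 2) ^ k1 * 5 + (n + 2) ^ k2 * 5 + 20).
  by polyb.
exists (Seqs (Assign m (Var 0)) [:: c1; Assign m.+1 (Var 0); Assign 0 (Var m);
  c2; Assign 0 (ECons (Var m.+1) (Var 0))]), m.+2, k.
split=> // i s si.
have [|t1 [s1 [e1 s10 f1 l1]]] := H1 i (upd s m (a i)); first by upds.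
have [|t2 [s2 [e2 s20 f2 l2]]] := H2 i (upd (upd s1 m.+1 (b i)) 0 (a i)).
  by upds.
have s1m : s1 m = a i by rewrite f1 //; upds.
have s2m : s2 m.+1 = b i by rewrite f2; [upds | lia].
eexists; exists (upd s2 0 (Node (b i) (c i))); split=> [|||].
- rewrite /Seqs /=; do ![apply: ExSeq].
  + by apply: ExAssign.
  + by rewrite /= si; exact: e1.
  + by apply: ExAssign.
  + by apply: ExAssign.
  + by rewrite /= s10; upds; rewrite s1m; exact: e2.
  + have -> : Node (b i) (c i) = eval s2 (ECons (Var m.+1) (Var 0)).
      by rewrite /= s2m s20.
    exact: ExAssign.
- by [].
- by move=> y my; upds; rewrite f2; [upds; rewrite f1; [upds | lia] | lia].
apply: leq_trans (kP _); rewrite /= si s10 s2m s20; upds.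
rewrite s1m; lia.
Qed.

Definition isnode (t : tree) : bool := if t is Node _ _ then true else false.

(** The branch for nodes also receives the test value, which is how a case analysis on a list
    obtains head and tail. Separate index types let each branch be specified on inputs of its own
    form. *)
Lemma ptree_branch I J1 J0 (a b g : I -> tree) (a1 b1 : J1 -> tree)
    (a0 b0 : J0 -> tree) :
  (forall i, isnode (g i) -> exists2 j, a1 j = Node (a i) (g i) & b1 j = b i) ->
  (forall i, ~~ isnode (g i) -> exists2 j, a0 j = a i & b0 j = b i) ->
  ptree a g -> ptree a1 b1 -> ptree a0 b0 -> ptree a b.
Proof.
move=> I1 I0 pg [c1 [n1 [k1 [n10 H1]]]] [c0 [n0 [k0 [n00 H0]]]].
have [c [n [k' [n_gt0 H]]]] := ptree_node (ptree_id a) pg.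
set m := maxn n (maxn n1 n0).
have [k kP] : polybounded (fun n => (n + 2) ^ k' * 10 + ((n + 2) ^ k' + 2) ^ k1
     + (n + 2) ^ k0 + 20) by polyb.
exists (Seq c (If (ETl (Var 0)) c1 (Seq (Assign 0 (EHd (Var 0))) c0))), m, k.
split=> [|i s si]; first lia.
have [t [s1 [e1 s10 f l]]] := H i s si.
case: (boolP (isnode (g i))) => gi.
  have [j aj bj] := I1 i gi.
  have [|t2 [s2 [e2 s20 f2 l2]]] := H1 j s1; first by rewrite aj.
  eexists; exists s2; split.
  - by apply: ExSeq e1 _; apply: ExIfTrue e2; rewrite /= s10; case: (g i) gi.
  - by rewrite s20.
  - by move=> y my; rewrite f2 ?f //; lia.
  apply: leq_trans (kP _) => /=; rewrite s10 /= -bj.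
  have : (tsize (a1 j) + 2) ^ k1 <= ((tsize (a i) + 2) ^ k' + 2) ^ k1.
    by rewrite aj; apply: leq_expr2; lia.
  move: l l2 => /=; lia.
have [j aj bj] := I0 i gi.
have [|t2 [s2 [e2 s20 f2 l2]]] := H0 j (upd s1 0 (a i)); first by rewrite aj.
eexists; exists s2; split.
- apply: ExSeq e1 _; apply: ExIfFalse; first by rewrite /= s10; case: (g i) gi.
  apply: ExSeq; first exact: ExAssign.
  by rewrite /= s10; exact: e2.
- by rewrite s20.
- by move=> y my; rewrite f2; [upds; rewrite f //; lia | lia].
apply: leq_trans (kP _) => /=; rewrite s10 /= -bj.
move: l l2; rewrite aj /=; lia.
Qed.

(** * Polynomial time functions on encoded data *)

Class code (X : Type) := enc : X -> tree.
#[local] Hint Mode code ! : typeclass_instances.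

#[local] Instance code_unit : code unit := fun=> Leaf.
#[local] Instance code_bool : code bool := enc_bool.
#[local] Instance code_nat : code nat := enc_nat.
#[local] Instance code_prod X Y {cX : code X} {cY : code Y} : code (X * Y) :=
  fun p => Node (enc p.1) (enc p.2).
#[local] Instance code_seq X {cX : code X} : code (seq X) := enc_seq enc.

Local Notation esize x := (tsize (enc x)).

Definition ptime X Y {cX : code X} {cY : code Y} (f : X -> Y) :=
  ptree (fun x => enc x) (fun x => enc (f x)).

Lemma esize_nil X {cX : code X} : esize ([::] : seq X) = 1. Proof. by []. Qed.

Lemma esize_cons X {cX : code X} (x : X) s :
  esize (x :: s) = (esize x + esize s).+1.
Proof. by []. Qed.

Lemma esize_pair X Y {cX : code X} {cY : code Y} (p : X * Y) :
  esize p = (esize p.1 + esize p.2).+1.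
Proof. by []. Qed.

Lemma esize_gt0 X {cX : code X} (x : X) : 0 < esize x.
Proof. exact: tsize_gt0. Qed.

Lemma esize_cat X {cX : code X} (s1 s2 : seq X) :
  (esize (s1 ++ s2)).+1 = esize s1 + esize s2.
Proof.
by elim: s1 => [|x s1 IH]; rewrite ?cat_cons ?esize_cons ?esize_nil //; lia.
Qed.

Lemma size_esize X {cX : code X} (s : seq X) : size s < esize s.
Proof. by elim: s => [|x s IH] //; rewrite esize_cons [size _]/=; lia. Qed.

(** * Bounded iteration over a list *)

Section Fold.
Context (E X Y : Type) {cE : code E} {cX : code X} {cY : code Y}.
Variables (g : E -> seq X) (z : E -> Y) (F : E -> X -> Y -> Y).

Local Notation fold e s := (foldl (fun y x => F e x y) (z e) s).

(** Variable [m] holds the environment, [m.+1] the unread part of the list and [m.+2] the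
    accumulator. *)
Let loop m cs := While (Var m.+1) (Seqs
  (Assign 0 (ECons (ECons (Var m) (EHd (Var m.+1))) (Var m.+2)))
  [:: cs; Assign m.+2 (Var 0); Assign m.+1 (ETl (Var m.+1))]).

(** Induction on the unread part [s2]. As [W] bounds the accumulator after every prefix, each round
    runs the body on an input of bounded size. *)
Lemma exec_fold_loop m cs n k W e s :
  0 < n -> n <= m ->
  (forall p : E * X * Y, forall s, s 0 = enc p -> exists t s',
    [/\ exec cs s t s', s' 0 = enc (F p.1.1 p.1.2 p.2),
      forall y, n <= y -> s' y = s y
      & t + esize (F p.1.1 p.1.2 p.2) <= (esize p + 2) ^ k]) ->
  (forall s1 s2, g e = s1 ++ s2 -> esize (fold e s1) <= W) ->
  forall s2 s1, g e = s1 ++ s2 ->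
    s m = enc e -> s m.+1 = enc s2 -> s m.+2 = enc (fold e s1) ->
  exists t s', [/\ exec (loop m cs) s t s', s' m.+2 = enc (fold e (g e)),
    forall y, m.+3 <= y -> s' y = s y
    & t <= (size s2).+1 * ((esize e + esize (g e) + W + 4) ^ k +
                           20 * (esize e + esize (g e) + W + 1))].
Proof.
move=> n0 nm csP bW s2; elim: s2 s => [|x s2 IH] s s1 gE sm sm1 sm2.
  eexists; exists s; split; first by apply: ExWhileFalse; rewrite /= sm1.
  - by rewrite gE cats0.
  - by [].
  by rewrite /= sm1 /=; lia.
set v := foldl _ _ _ in sm2.
have [|t [s' [e' s'0 f l]]] :=
  csP (e, x, v) (upd s 0 (Node (Node (enc e) (enc x)) (enc v))).
  by upds.
rewrite /= in s'0 l.
have gE' : g e = rcons s1 x ++ s2 by rewrite cat_rcons.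
have vE : F e x v = fold e (rcons s1 x) by rewrite foldl_rcons.
have [|||t3 [s3 [e3 s30 f3 l3]]] := IH (upd (upd s' m.+2 (enc (F e x v)))
   m.+1 (enc s2)) (rcons s1 x) gE'.
- by upds; rewrite f //; upds.
- by upds.
- by upds; rewrite vE.
eexists; exists s3; split.
- apply: ExWhileTrue e3; first by rewrite /= sm1.
  rewrite /Seqs /=; do ![apply: ExSeq].
  + by apply: ExAssign.
  + by rewrite /= sm sm1 sm2; exact: e'.
  + by apply: ExAssign.
  + have -> : enc s2 = eval (upd s' m.+2 (s' 0)) (ETl (Var m.+1)).
      by rewrite /=; upds; rewrite f; [upds; rewrite sm1 | lia].
    by rewrite -s'0; exact: ExAssign.
- by [].
- by move=> y my; rewrite f3 //; upds; rewrite f; [upds | lia].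
have s'm : s' m.+1 = enc (x :: s2) by rewrite f; [upds | lia].
rewrite /= sm sm1 sm2 s'0; upds; rewrite s'm /=.
have vW : esize v <= W by apply: bW gE.
have v'W : esize (F e x v) <= W by rewrite vE; apply: bW gE'.
have gS : (esize x + esize s2).+1 <= esize (g e).
  rewrite gE; pose proof (esize_cat s1 (x :: s2)) as H1.
  pose proof (esize_gt0 s1) as H2; move: H1 H2.
  rewrite esize_cons; lia.
(* The 4 consists of the two pair nodes of [(e, x, v)] and the 2 in the bound for the body. *)
have : (esize (e, x, v) + 2) ^ k <= (esize e + esize (g e) + W + 4) ^ k.
  have -> : esize e + esize (g e) + W + 4 = (esize e + esize (g e) + W + 2) + 2.
    by lia.
  apply: leq_expr2; rewrite !esize_pair /=; lia.
rewrite -[code_seq s2]/(enc s2) mulSn => lk.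
move: l l3 lk; rewrite !esize_pair /=; lia.
Qed.

(* The last hypothesis bounds all intermediate values of the iteration: without
   it, folding a function that doubles the size would take exponential time. *)
Lemma ptime_fold : ptime g -> ptime z ->
  ptime (fun p : E * X * Y => F p.1.1 p.1.2 p.2) ->
  (exists2 f, polybounded f & forall e s1 s2, g e = s1 ++ s2 ->
    esize (fold e s1) <= f (esize e)) ->
  ptime (fun e => fold e (g e)).
Proof.
move=> pg pz [cs [n [k [n0 csP]]]] [f [kf pf] bf].
have [kg kgP] : exists kg, forall e, esize (g e) <= (esize e + 2) ^ kg.
  have [c' [n' [k' [_ H]]]] := pg; exists k' => e.
  have [t [s' [_ _ _ l]]] := H e (fun=> enc e) erefl; lia.
have [cp [np [kp [np0 cpP]]]] := ptree_node (ptree_id (fun x => enc x))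
   (ptree_node pg pz).
set m := maxn n np; have nm : n <= m by lia. have npm : np <= m by lia.
(* [D N] bounds one round of the loop in an environment of size [N]. *)
pose D N := (N + (N + 2) ^ kg + (N + 2) ^ kf + 2 + 2) ^ k +
            20 * (N + (N + 2) ^ kg + (N + 2) ^ kf + 1).
have [K KP] : polybounded (fun N => (N + 2) ^ kp * 20 + D N * ((N + 2) ^ kg + 1) +
     (N + 2) ^ kf * 20 + 20) by rewrite /D; polyb.
exists (Seqs cp [:: Assign m (EHd (Var 0)); Assign m.+1 (EHd (ETl (Var 0)));
  Assign m.+2 (ETl (ETl (Var 0))); loop m cs; Assign 0 (Var m.+2)]), m.+3, K.
split=> // e s se.
have [t1 [s1 [e1 s10 f1 l1]]] := cpP e s se.
have bW : forall s1 s2, g e = s1 ++ s2 -> esize (fold e s1) <= (esize e + 2) ^ kf.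
  by move=> ? ? /bf/leq_trans; apply.
have [||||t3 [s3 [e3 s30 f3 l3]]] :=
  @exec_fold_loop m cs n k _ e
    (upd (upd (upd s1 m (enc e)) m.+1 (enc (g e))) m.+2 (enc (z e)))
    n0 nm csP bW (g e) [::]; try by upds.
eexists; exists (upd s3 0 (enc (fold e (g e)))); split.
- rewrite /Seqs /=; do ![apply: ExSeq].
  + exact: e1.
  + exact: ExAssign.
  + exact: ExAssign.
  + exact: ExAssign.
  + by rewrite /= s10; upds; rewrite s10; exact: e3.
  + by rewrite -s30; exact: (ExAssign 0 (Var m.+2)).
- by upds.
- by move=> y my; upds; rewrite f3 //; upds; rewrite f1 //; lia.
apply: leq_trans (KP _); rewrite /= s10 /=; upds; rewrite s10 /=; upds.
rewrite s30.
have Wg := bW (g e) [::] (esym (cats0 _)).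
have sz : (size (g e)).+1 <= (esize e + 2) ^ kg + 1.
  pose proof (size_esize (g e)) as Hs.
  by have := kgP e; lia.
have DD : (esize e + esize (g e) + (esize e + 2) ^ kf + 4) ^ k +
   20 * (esize e + esize (g e) + (esize e + 2) ^ kf + 1) <= D (esize e).
  rewrite /D leq_add //; last by have := kgP e; lia.
  have -> : forall a, a + 4 = a + 2 + 2 by lia.
  by apply: leq_expr2; have := kgP e; lia.
have l3' : t3 <= D (esize e) * ((esize e + 2) ^ kg + 1).
  by apply: leq_trans l3 _; rewrite mulnC leq_mul.
move: l1 l3' => /=; lia.
Qed.

End Fold.

(** * Closure properties of polynomial time *)

Section Combinators.
Context (E : Type) {cE : code E}.

(** The identity program changes the type at which a tree is read. *)
Lemma ptime_recode X Y {cX : code X} {cY : code Y} (f : X -> Y) :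
  (forall x, enc x = enc (f x)) -> ptime f.
Proof. by move=> H; apply: ptree_ext (ptree_id _). Qed.

Lemma ptime_ext Y {cY : code Y} (f g : E -> Y) : f =1 g -> ptime f -> ptime g.
Proof. by move=> fg; apply: ptree_ext => // e; rewrite fg. Qed.

Lemma ptime_id : ptime (fun e : E => e).
Proof. exact: ptree_id. Qed.

Lemma ptime_const Y {cY : code Y} (y : Y) : ptime (fun _ : E => y).
Proof. exact: ptree_const. Qed.

Lemma ptime_app X Y {cX : code X} {cY : code Y} (f : X -> Y) (g : E -> X) :
  ptime f -> ptime g -> ptime (fun e => f (g e)).
Proof. by move=> pf pg; apply: ptree_comp pg pf. Qed.

Lemma ptime_pair X Y {cX : code X} {cY : code Y} (f : E -> X) (g : E -> Y) :
  ptime f -> ptime g -> ptime (fun e => (f e, g e)).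
Proof. exact: ptree_node. Qed.

Lemma ptime_fst X Y {cX : code X} {cY : code Y} (f : E -> X * Y) :
  ptime f -> ptime (fun e => (f e).1).
Proof. by apply: ptime_app; apply: ptree_hd. Qed.

Lemma ptime_snd X Y {cX : code X} {cY : code Y} (f : E -> X * Y) :
  ptime f -> ptime (fun e => (f e).2).
Proof. by apply: ptime_app; apply: ptree_tl. Qed.

Lemma ptime_cons X {cX : code X} (f : E -> X) (g : E -> seq X) :
  ptime f -> ptime g -> ptime (fun e => f e :: g e).
Proof. exact: ptree_node. Qed.

Lemma ptime_if Y {cY : code Y} (b : E -> bool) (f g : E -> Y) :
  ptime b -> ptime f -> ptime g -> ptime (fun e => if b e then f e else g e).
Proof.
move=> pb pf pg.
apply: (ptree_branch (a1 := fun p : E * bool => enc p) (b1 := fun p => enc (f p.1))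
   (a0 := fun e => enc e) (b0 := fun e => enc (g e))) pb _ pg.
- by move=> e; case be: (b e) => // _; exists (e, true).
- by move=> e; case be: (b e) => // _; exists e.
by apply: (ptree_comp (f := fst)) pf => //; apply: ptree_hd.
Qed.

Lemma ptime_case X Y {cX : code X} {cY : code Y} (g : E -> seq X)
    (F : E -> X -> seq X -> Y) (z : E -> Y) :
  ptime g -> ptime (fun p : E * (X * seq X) => F p.1 p.2.1 p.2.2) -> ptime z ->
  ptime (fun e => if g e is x :: s then F e x s else z e).
Proof.
move=> pg pF pz; apply: ptree_branch pg pF pz.
(* The tree of [x :: s] is also the tree of the pair [(x, s)]. *)
- by move=> e; case ge: (g e) => [|x s] // _; exists (e, (x, s)).
- by move=> e; case ge: (g e) => [|x s] // _; exists e.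
Qed.

Lemma ptime_esize Y {cY : code Y} (f : E -> Y) :
  ptime f -> exists k, forall e, esize (f e) <= (esize e + 2) ^ k.
Proof.
move=> [c [n [k [n0 H]]]]; exists k => e.
by have [t [s [_ _ _ l]]] := H e (fun=> enc e) erefl; lia.
Qed.

End Combinators.

(* The heads are matched first because eta for pairs makes [apply: ptime_pair]
   succeed on every function with values in a product. *)
Ltac ptime_step := first
  [ assumption | apply: ptime_id | apply: ptime_const
  | lazymatch goal with
    | |- ptime fst => apply: ptime_fst
    | |- ptime snd => apply: ptime_snd
    | |- ptime (fun e => fst _) => apply: ptime_fst
    | |- ptime (fun e => snd _) => apply: ptime_snd
    | |- ptime (fun e => (_, _)) => apply: ptime_pair
    | |- ptime (fun e => _ :: _) => apply: ptime_cons
    | |- ptime (fun e => if _ then _ else _) => apply: ptime_if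
    | |- ptime (fun e => match _ with [::] => _ | _ :: _ => _ end) => apply: ptime_case
    end ].
Ltac ptimes := repeat ptime_step.

Lemma ptime_andb E {cE : code E} (f g : E -> bool) :
  ptime f -> ptime g -> ptime (fun e => f e && g e).
Proof. by move=> pf pg; rewrite /andb; ptimes. Qed.

Lemma ptime_orb E {cE : code E} (f g : E -> bool) :
  ptime f -> ptime g -> ptime (fun e => f e || g e).
Proof. by move=> pf pg; rewrite /orb; ptimes. Qed.

Lemma ptime_negb E {cE : code E} (f : E -> bool) : ptime f -> ptime (fun e => ~~ f e).
Proof. by move=> pf; rewrite /negb; ptimes. Qed.

(** * List functions *)

Lemma esize_catrev X {cX : code X} (s1 s2 : seq X) :
  (esize (catrev s1 s2)).+1 = esize s1 + esize s2.
Proof.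
elim: s1 s2 => [|x s1 IH] s2 //; rewrite [catrev _ _]/=.
by have := IH (x :: s2); rewrite !esize_cons; lia.
Qed.

Lemma esize_bool (b : bool) : esize b <= 3.
Proof. by case: b. Qed.

(** A left fold that conses computes exactly this function; reversal and concatenation are then
    derived from it. *)
Lemma ptime_catrev E X {cE : code E} {cX : code X} (f g : E -> seq X) :
  ptime f -> ptime g -> ptime (fun e => catrev (f e) (g e)).
Proof.
move=> pf pg.
have foldE s1 s2 : foldl (fun y (x : X) => x :: y) s2 s1 = catrev s1 s2.
  by elim: s1 s2 => //= x s1 IH s2; rewrite IH.
have [kf kfP] := ptime_esize pf; have [kg kgP] := ptime_esize pg.
apply: (ptime_ext (fun e => foldE _ _)).
apply: ptime_fold => //; first by ptimes.
exists (fun n => (n + 2) ^ kf + (n + 2) ^ kg); first by polyb.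
move=> e s1 s2 fe; rewrite foldE.
pose proof (esize_catrev s1 (g e)); pose proof (esize_cat s1 s2) as H2.
pose proof (esize_gt0 s2); rewrite -fe in H2; have := kfP e; have := kgP e; lia.
Qed.

Lemma ptime_rev E X {cE : code E} {cX : code X} (f : E -> seq X) :
  ptime f -> ptime (fun e => rev (f e)).
Proof. by move=> pf; apply: ptime_catrev => //; ptimes. Qed.

Lemma ptime_cat E X {cE : code E} {cX : code X} (f g : E -> seq X) :
  ptime f -> ptime g -> ptime (fun e => f e ++ g e).
Proof.
move=> pf pg.
have catE s1 s2 : catrev (rev s1) s2 = s1 ++ s2 :> seq X by rewrite catrevE revK.
apply: (ptime_ext (fun e => catE _ _)).
by apply: ptime_catrev => //; apply: ptime_rev.
Qed.

Lemma leq_esize_flatten_map X Y {cX : code X} {cY : code Y} (f : X -> seq Y) s M B :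
  (forall x, esize x <= M -> esize (f x) <= B) -> esize s <= M ->
  esize (flatten (map f s)) <= size s * B + 1.
Proof.
move=> fB; elim: s => [|x s IH] //; rewrite esize_cons => sM /=.
pose proof (esize_cat (f x) (flatten (map f s))).
by have := fB x; have := IH; rewrite mulSn; lia.
Qed.

(** The fold collects the pieces in reverse and reverses once at the end. Map and filter follow by
    taking pieces of length at most one. *)
Lemma ptime_flatten_map E X Y {cE : code E} {cX : code X} {cY : code Y}
    (F : E -> X -> seq Y) (g : E -> seq X) :
  ptime (fun p : E * X => F p.1 p.2) -> ptime g ->
  ptime (fun e => flatten [seq F e x | x <- g e]).
Proof.
move=> pF pg.
have foldE e s : foldl (fun y x => catrev (F e x) y) [::] s =
    rev (flatten (map (F e) s)).
  rewrite -[RHS]cats0; elim: s [::] => //= x s IH s0.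
  by rewrite IH catrevE catA rev_cat.
have revE e : rev (foldl (fun y x => catrev (F e x) y) [::] (g e)) =
    flatten (map (F e) (g e)) by rewrite foldE revK.
apply: (ptime_ext revE).
apply: ptime_rev.
have [kg kgP] := ptime_esize pg; have [kF kFP] := ptime_esize pF.
apply: ptime_fold => //; first by ptimes.
  apply: ptime_catrev; last by ptimes.
  by apply: (ptime_app (f := fun p : E * X => F p.1 p.2) (g := fst)) => //; ptimes.
exists (fun n => (n + 2) ^ kg * (n + (n + 2) ^ kg + 1 + 2) ^ kF + 1); first by polyb.
move=> e s1 s2 ge; rewrite foldE.
set s := flatten _; pose proof (esize_catrev s [::]) as Hs.
have {Hs} -> : esize (rev s) = esize s.
  by rewrite /rev; move: Hs; rewrite esize_nil; lia.
have [s1g s1g'] : esize s1 <= esize (g e) /\ size s1 <= esize (g e).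
  rewrite ge; pose proof (esize_cat s1 s2); pose proof (esize_gt0 s2).
  by pose proof (size_esize s1); lia.
apply: leq_trans (leq_esize_flatten_map (M := esize (g e)) 
  (B := (esize e + esize (g e) + 1 + 2) ^ kF) _ s1g) _.
  move=> x xg; apply: leq_trans (kFP (e, x)) _.
  by apply: leq_expr2; rewrite esize_pair /=; lia.
rewrite leq_add2r leq_mul //; first exact: leq_trans s1g' (kgP e).
by apply: leq_expr2; rewrite !leq_add2r leq_add2l.
Qed.

Lemma ptime_map E X Y {cE : code E} {cX : code X} {cY : code Y}
    (F : E -> X -> Y) (g : E -> seq X) :
  ptime (fun p : E * X => F p.1 p.2) -> ptime g ->
  ptime (fun e => [seq F e x | x <- g e]).
Proof.
move=> pF pg.
have mapE e : flatten [seq [:: F e x] | x <- g e] = [seq F e x | x <- g e].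
  by rewrite flatten_map1.
apply: (ptime_ext mapE).
by apply: ptime_flatten_map => //; ptimes.
Qed.

Lemma ptime_filter E X {cE : code E} {cX : code X}
    (P : E -> X -> bool) (g : E -> seq X) :
  ptime (fun p : E * X => P p.1 p.2) -> ptime g ->
  ptime (fun e => [seq x <- g e | P e x]).
Proof.
move=> pF pg.
have filterE e : flatten [seq if P e x then [:: x] else [::] | x <- g e] =
    [seq x <- g e | P e x].
  by elim: (g e) => //= x s ->; case: (P e x).
apply: (ptime_ext filterE).
by apply: ptime_flatten_map => //; ptimes.
Qed.

Lemma ptime_has E X {cE : code E} {cX : code X} (P : E -> X -> bool) (g : E -> seq X) :
  ptime (fun p : E * X => P p.1 p.2) -> ptime g ->
  ptime (fun e => has (P e) (g e)).
Proof.
move=> pF pg.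
have foldE e s b : foldl (fun b x => P e x || b) b s = has (P e) s || b.
  by elim: s b => //= x s IH b; rewrite IH orbA [X in X || b]orbC.
have {}foldE e : foldl (fun b x => P e x || b) false (g e) = has (P e) (g e).
  by rewrite foldE orbF.
apply: (ptime_ext foldE).
apply: ptime_fold => //; first by ptimes.
  apply: ptime_orb; last by ptimes.
  by apply: (ptime_app (f := fun p : E * X => P p.1 p.2) (g := fst)) => //; ptimes.
by exists (fun=> 3); [polyb | move=> *; apply: esize_bool].
Qed.

Ltac ptime_extra := fail.

Ltac ptime_lists := lazymatch goal with
  | |- ptime (fun e => andb _ _) => apply: ptime_andb
  | |- ptime (fun e => orb _ _) => apply: ptime_orb
  | |- ptime (fun e => negb _) => apply: ptime_negb
  | |- ptime (fun e => cat _ _) => apply: ptime_cat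
  | |- ptime (fun e => rev _) => apply: ptime_rev
  | |- ptime (fun e => flatten (map _ _)) => apply: ptime_flatten_map
  | |- ptime (fun e => map _ _) => apply: ptime_map
  | |- ptime (fun e => filter _ _) => apply: ptime_filter
  | |- ptime (fun e => has _ _) => apply: ptime_has
  end.

Ltac ptimes ::= repeat first [ptime_step | ptime_extra | ptime_lists].

(** * Unary arithmetic and equality tests *)

Lemma enc_nat_nseq n : enc n = enc (nseq n tt).
Proof. by elim: n => //= n IH; congr Node. Qed.

Lemma esize_nat (n : nat) : esize n = n.*2.+1.
Proof. by elim: n => [|n IH] //; rewrite -[esize n.+1]/(esize n).+2 IH. Qed.

(** A change of type without computation, as numbers are unary; arithmetic thus reduces to list
    operations. *)
Lemma ptime_nseq_unit E {cE : code E} (f : E -> nat) :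
  ptime f -> ptime (fun e => nseq (f e) tt).
Proof. by apply: ptime_app; apply: ptime_recode => n; rewrite enc_nat_nseq. Qed.

Lemma ptime_size_unit E {cE : code E} (f : E -> seq unit) :
  ptime f -> ptime (fun e => size (f e)).
Proof.
apply: ptime_app; apply: ptime_recode => s.
by rewrite enc_nat_nseq; congr enc; elim: s => //= -[] s {1}->.
Qed.

Lemma ptime_addn E {cE : code E} (f g : E -> nat) :
  ptime f -> ptime g -> ptime (fun e => f e + g e).
Proof.
move=> pf pg; have H e : size (nseq (f e) tt ++ nseq (g e) tt) = f e + g e.
  by rewrite size_cat !size_nseq.
apply: (ptime_ext H).
by apply: ptime_size_unit; ptimes; apply: ptime_nseq_unit.
Qed.

Lemma ptime_subn E {cE : code E} (f g : E -> nat) :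
  ptime f -> ptime g -> ptime (fun e => f e - g e).
Proof.
move=> pf pg; have H s (m : nat) : foldl (fun y (_ : unit) => y.-1) m s = m - size s.
  by elim: s m => [|x s IH] m /=; rewrite ?subn0 // IH -subn1 subnS; lia.
have {}H e : foldl (fun y (_ : unit) => y.-1) (f e) (nseq (g e) tt) = f e - g e.
  by rewrite H size_nseq.
apply: (ptime_ext H).
have [kf kfP] := ptime_esize pf.
apply: ptime_fold => //; first exact: ptime_nseq_unit.
  have P (y : nat) : size (if nseq y tt is _ :: s then s else [::]) = y.-1.
    by case: y => //= y; rewrite size_nseq.
  apply: (ptime_ext (fun e => P e.2)).
  by apply: ptime_size_unit; ptimes; apply: ptime_nseq_unit; ptimes.
exists (fun n => (n + 2) ^ kf); first by polyb.
move=> e s1 s2 _; apply: leq_trans (kfP e); rewrite !esize_nat.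
elim: s1 (f e) => //= x s1 IH m; apply: leq_trans (IH _) _; lia.
Qed.

Lemma ptime_ltn E {cE : code E} (f g : E -> nat) :
  ptime f -> ptime g -> ptime (fun e => f e < g e).
Proof.
move=> pf pg.
have H e : (if nseq (g e - f e) tt is _ :: _ then true else false) = (f e < g e).
  by rewrite -subn_gt0; case: (_ - _).
apply: (ptime_ext H).
by ptimes; apply: ptime_nseq_unit; apply: ptime_subn.
Qed.

Class ptime_eqType (T : eqType) {cT : code T} : Prop :=
  ptime_eqb : ptime (fun p : T * T => p.1 == p.2).

Lemma ptime_eq E (T : eqType) {cE : code E} {cT : code T} (f g : E -> T) :
  ptime_eqType (T := T) -> ptime f -> ptime g -> ptime (fun e => f e == g e).
Proof.
move=> pT pf pg.
apply: (ptime_app (f := fun p : T * T => p.1 == p.2) (g := fun e => (f e, g e))) pT _.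
by ptimes.
Qed.

Ltac ptime_extra ::= lazymatch goal with
  | |- ptime (fun e => addn _ _) => apply: ptime_addn
  | |- ptime (fun e => leq (S _) _) => apply: ptime_ltn
  | |- ptime (fun e => eq_op _ _) => apply: ptime_eq
  end.

#[local] Instance ptime_eq_nat : ptime_eqType (T := nat).
Proof.
have H (p : nat * nat) : ~~ (p.1 < p.2) && ~~ (p.2 < p.1) = (p.1 == p.2).
  by rewrite -!leqNgt eqn_leq andbC.
by apply: (ptime_ext H); ptimes.
Qed.

#[local] Instance ptime_eq_bool : ptime_eqType (T := bool).
Proof.
have H (p : bool * bool) : (if p.1 then p.2 else ~~ p.2) = (p.1 == p.2).
  by case: p => [[] []].
by apply: (ptime_ext H); ptimes.
Qed.

#[local] Instance ptime_eq_prod (S T : eqType) {cS : code S} {cT : code T} :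
  ptime_eqType (T := S) -> ptime_eqType (T := T) -> ptime_eqType (T := (S * T)%type).
Proof.
move=> pS pT.
have H (p : (S * T) * (S * T)) :
    (p.1.1 == p.2.1) && (p.1.2 == p.2.2) = (p.1 == p.2).
  by case: p => [[? ?] [? ?]].
by apply: (ptime_ext H); ptimes.
Qed.

#[local] Instance ptime_eq_seq (T : eqType) {cT : code T} :
  ptime_eqType (T := T) -> ptime_eqType (T := seq T).
Proof.
move=> pT.
(* The fold over the first list carries the unread part of the second and the verdict so far; an
   early end of the second list makes the verdict false. *)
pose st (x : T) (y : seq T * bool) :=
  if y.1 is x' :: r then (r, y.2 && (x == x')) else ([::], false).
have F s r b : let y := foldl (fun y x => st x y) (r, b) s in
    (y.1 == [::]) && y.2 = b && (s == r).
  elim: s r b => [|x s IH] [|x' r] b /=; rewrite ?andbT ?andbF ?IH //.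
  by rewrite eqseq_cons andbA.
have H (p : seq T * seq T) : let y := foldl (fun y x => st x y) (p.2, true) p.1 in
    (if y.1 is _ :: _ then false else true) && y.2 = (p.1 == p.2).
  by have := F p.1 p.2 true => /= <-; case: (foldl _ _ _) => [[]].
apply: (ptime_ext H).
enough (ptime (fun p : seq T * seq T => foldl (fun y x => st x y) (p.2, true) p.1)).
  by ptimes.
apply: ptime_fold; try by ptimes.
  by rewrite /st; ptimes.
(* 3 for the verdict and 1 for the pair node. *)
exists (fun n => n + 4); first by polyb.
move=> [s r] s1 s2 _; rewrite [esize (s, r)]esize_pair [(s, r).2]/=.
have : forall r b, esize (foldl (fun y x => st x y) (r, b) s1) <= esize r + 4.
  elim: s1 => [|x s1 IH] r' b.
    by rewrite [esize (r', b)]esize_pair /=; pose proof (esize_bool b); lia.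
  rewrite [foldl _ _ _]/= {2}/st; case: r' => [|x' r']; first exact: IH.
  by apply: leq_trans (IH r' _) _; rewrite esize_cons; lia.
by move/(_ r true); lia.
Qed.

Lemma ptime_mem E (T : eqType) {cE : code E} {cT : code T} (f : E -> T)
    (g : E -> seq T) :
  ptime_eqType (T := T) -> ptime f -> ptime g -> ptime (fun e => f e \in g e).
Proof.
move=> pT pf pg; have H e : has (fun x => x == f e) (g e) = (f e \in g e).
  by rewrite has_pred1.
apply: (ptime_ext H); ptimes.
by apply: (ptime_app (f := f)) => //; ptimes.
Qed.
(** * Saturation and shortest walks *)

Section Saturate.
Variable T : eqType.
Implicit Types (R U : seq T) (st : seq T -> T -> bool).

(** Keeping the members of [R] makes the rounds increase, and filtering [U] keeps every round a
    sublist of [U]. *)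
Definition saturate_step st U R := [seq u <- U | (u \in R) || st R u].

(* Every round before the fixed point is reached adds an element of [U], so
   [size U] rounds are enough. *)
Definition saturate st U := foldl (fun R _ => saturate_step st U R) [::] U.

Lemma saturate_sub st U s :
  {subset foldl (fun R (_ : T) => saturate_step st U R) [::] s <= U}.
Proof.
by elim/last_ind: s => // s x _ u; rewrite foldl_rcons mem_filter => /andP[].
Qed.

Lemma saturate_ind st U (P : T -> Prop) :
  (forall R u, (forall v, v \in R -> P v) -> u \in U -> st R u -> P u) ->
  forall u, u \in saturate st U -> P u.
Proof.
move=> H; rewrite /saturate; elim/last_ind: {2}U => // s x IH u.
rewrite foldl_rcons mem_filter => /andP[/orP[/IH //|] st_u uU].
exact: H st_u.
Qed.

Lemma saturate_closed st U v :
  v \in U -> st (saturate st U) v -> v \in saturate st U.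
Proof.
pose closed R := all (fun u => st R u ==> (u \in R)) U.
(* Writing the result as [filter P U] lets progress be measured by [count] in [U], with
   multiplicities: either a closed set has been reached, or at least as many elements are present as
   rounds were made. *)
have [P [sE]] : exists P : pred T, saturate st U = filter P U /\
    closed (saturate st U) || (size U <= size (saturate st U)); last first.
  case/orP=> [/allP cl|]; first by move=> vU; apply/implyP/cl.
  rewrite sE size_filter => sP vU _; rewrite mem_filter vU andbT.
  have : all P U by rewrite all_count eqn_leq count_size.
  by move/allP; apply.
have {v} : forall s : seq T, exists P : pred T,
  let R := foldl (fun R _ => saturate_step st U R) [::] s in
  R = filter P U /\ closed R || (size s <= size R); last exact.
move=> s; elim/last_ind: s => [|s x [P /= [RE IH]]].
  by exists pred0; rewrite filter_pred0 /= orbT.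
rewrite foldl_rcons size_rcons; set R := foldl _ _ _ in RE IH *.
have RP w : w \in U -> w \in R = P w by move=> wU; rewrite RE mem_filter wU andbT.
have nE : saturate_step st U R = filter (predU P (st R)) U.
  by apply: eq_in_filter => w wU /=; rewrite RP.
exists (predU P (st R)); split=> //.
case: (boolP (closed R)) => [cl|/allPn[u uU]].
  suff -> : saturate_step st U R = R by rewrite cl.
  rewrite nE [RHS]RE; apply: eq_in_filter => w wU /=.
  by have := allP cl w wU; rewrite RP //; case: (P w) (st R w) => [] [].
rewrite negb_imply RP // => /andP[stu Pu]; apply/orP; right.
have sR : size s <= size R.
  case/orP: IH => // cl; have := allP cl u uU.
  by rewrite stu RP // (negbTE Pu).
apply: leq_ltn_trans sR _; rewrite nE [in X in X < _]RE !size_filter.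
have -> : count (predU P (st R)) U = count P U + count (predD (st R) P) U.
  rewrite -count_predUI [X in _ = _ + X](_ : _ = 0) ?addn0.
    apply: eq_count => w /=; by case: (P w); rewrite ?orbT //= orbF.
  by apply/eqP; rewrite -leqn0 leqNgt -has_count; apply/hasPn => w _ /=; case: (P w).
rewrite -addn1 leq_add2l -has_count; apply/hasP; exists u => //=.
by rewrite Pu.
Qed.

End Saturate.

(** * Shortest walks by rounds of relaxation *)

Section ShortestWalks.
Variables (K L : eqType).
Local Notation config := (K * (seq L * seq L * nat))%type.
Implicit Types (c d : config) (s : seq config).

Definition cost c : nat := c.2.2.

(** A list of length at most one stands for an option, so that the list combinators apply. *)
Definition cheapest s : seq config :=
  foldl (fun m c => if m is d :: _ then if cost c < cost d then [:: c] else m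
                    else [:: c]) [::] s.

Lemma cheapest_rcons s c : cheapest (rcons s c) =
  if cheapest s is d :: _ then if cost c < cost d then [:: c] else cheapest s
  else [:: c].
Proof. by rewrite /cheapest foldl_rcons. Qed.

Lemma cheapest_sub s : {subset cheapest s <= s}.
Proof.
elim/last_ind: s => // s c IH d; rewrite cheapest_rcons mem_rcons inE.
case Es: (cheapest s) => [|e r]; first by rewrite inE => ->.
case: ifP => _; first by rewrite inE => ->.
by rewrite -Es => /IH->; rewrite orbT.
Qed.

Lemma size_cheapest s : size (cheapest s) <= 1.
Proof.
elim/last_ind: s => // s c; rewrite cheapest_rcons.
by case: (cheapest s) => [|d r] //; case: ifP.
Qed.

Lemma cheapest_min s c : c \in s -> exists2 d, d \in cheapest s & cost d <= cost c.
Proof.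
elim/last_ind: s => // s c' IH; rewrite mem_rcons inE cheapest_rcons.
have := size_cheapest s; case Es: (cheapest s) IH => [|e [|//]] IH _.
  by case/orP=> [/eqP-> | /IH[]//]; exists c'; rewrite ?inE.
case: ltnP => ce /orP[/eqP-> | /IH[d]].
- by exists c'; rewrite ?inE.
- rewrite inE => /eqP-> ec; exists c'; rewrite ?inE //.
  exact: leq_trans (ltnW ce) ec.
- by exists e; rewrite ?inE.
by exists d.
Qed.

(* A configuration consists of a vertex, the labels of a walk to it and its
   weight; [delta k] lists the edges that leave [k]. *)
Variable delta : K -> seq config.

(** New labels go in front because words are read from right to left. *)
Definition extend c : seq config :=
  [seq (m.1, (m.2.1.1 ++ c.2.1.1, m.2.1.2 ++ c.2.1.2, m.2.2 + c.2.2))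
  | m <- delta c.1].

Variables (U : seq K) (k0 : K).

(** At most one entry per element of [U] survives a round; keeping all extensions would let the
    table grow exponentially. *)
Definition relax s : seq config :=
  flatten [seq cheapest [seq c <- s ++ flatten [seq extend c | c <- s] | c.1 == k]
          | k <- U].

Definition start : config := (k0, ([::], [::], 0)).

Definition shortest : seq config := foldl (fun s _ => relax s) [:: start] U.

Definition walk := path (fun c d => d \in extend c).

Lemma relax_sub s c : c \in relax s ->
  c.1 \in U /\ (c \in s \/ exists2 d, d \in s & c \in extend d).
Proof.
case/flatten_mapP=> k kU /cheapest_sub.
rewrite mem_filter mem_cat => /andP[/eqP-> cs]; split=> //.
by case/orP: cs => [|/flatten_mapP[d ds cd]]; [left | right; exists d].
Qed.

Lemma relax_min s c d : c \in s -> d = c \/ d \in extend c -> d.1 \in U ->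
  exists e, [/\ e \in relax s, e.1 = d.1 & cost e <= cost d].
Proof.
move=> cs dc dU.
have dS : d \in [seq c <- s ++ flatten [seq extend c | c <- s] | c.1 == d.1].
  rewrite mem_filter eqxx mem_cat; apply/orP.
  by case: dc => [->|dc]; [left | right; apply/flatten_mapP; exists c].
have [e eC ed] := cheapest_min dS; exists e; split=> //.
  by apply/flatten_mapP; exists d.1.
by have := cheapest_sub eC; rewrite mem_filter => /andP[/eqP].
Qed.

Lemma extend_cost c d : d \in extend c -> cost c <= cost d.
Proof. by case/mapP=> m _ ->; rewrite /cost leq_addl. Qed.

(** The edges available depend on the vertex only and add the same weight to any configuration
    there. This exchange argument serves both relaxation and the removal of cycles. *)
Lemma extend_sim c c' d : d \in extend c -> c'.1 = c.1 -> cost c' <= cost c ->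
  exists d', [/\ d' \in extend c', d'.1 = d.1 & cost d' <= cost d].
Proof.
case/mapP=> m mD -> kc lc.
exists (m.1, (m.2.1.1 ++ c'.2.1.1, m.2.1.2 ++ c'.2.1.2, m.2.2 + c'.2.2)).
by split=> //; [rewrite /extend kc map_f | rewrite /cost leq_add2l].
Qed.

Lemma walk_cost c s : walk c s -> cost c <= cost (last c s).
Proof.
elim: s c => //= d s IH c /andP[/extend_cost cd /IH]; exact: leq_trans.
Qed.

Lemma walk_sim c c' s : walk c s -> c'.1 = c.1 -> cost c' <= cost c ->
  exists s', [/\ walk c' s', size s' = size s, (last c' s').1 = (last c s).1
              & cost (last c' s') <= cost (last c s)].
Proof.
elim: s c c' => [|d s IH] c c' /=; first by exists [::].
case/andP=> cd ds kc lc; have [d' [cd' kd ld]] := extend_sim cd kc lc.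
have [s' [ws ss ks ls]] := IH d d' ds kd ld.
by exists (d' :: s'); split; rewrite //= ?cd' ?ss.
Qed.

Lemma walk_min s : walk start s -> all (fun c => c.1 \in U) s -> k0 \in U ->
  forall n, size s <= n ->
  exists e, [/\ e \in iter n relax [:: start], e.1 = (last start s).1
             & cost e <= cost (last start s)].
Proof.
move=> ws sU kU n sn.
have {sn sU} : all (fun c => c.1 \in U) s /\ size s <= n by [].
elim: n s ws => [|n IH] s ws [sU sn].
  by case: s sn {ws sU} => // _; exists start; rewrite /= inE.
case/lastP: s ws sU sn => [|s d] ws.
  (* The entry for the empty walk must survive later rounds, which uses [k0 \in U]. *)
  move=> _ _; have [//|e [en ke le]] := IH [::] isT.
  have [|f [fn kf lf]] := relax_min en (or_introl erefl); first by rewrite ke.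
  by exists f; split=> //; [rewrite kf | apply: leq_trans lf le].
rewrite all_rcons size_rcons last_rcons => /andP[dU sU] sn.
move: ws; rewrite /walk rcons_path => /andP[ws sd].
have [e [en ke le]] := IH s ws (conj sU sn).
have [d' [ed' kd ld]] := extend_sim sd ke le.
have [|f [fn kf lf]] := relax_min en (or_intror ed'); first by rewrite kd.
by exists f; split=> //; [rewrite kf | apply: leq_trans lf ld].
Qed.

Hypothesis delta_U : forall k m, k \in U -> m \in delta k -> m.1 \in U.

Lemma walk_U c s : c.1 \in U -> walk c s -> all (fun c => c.1 \in U) s.
Proof.
elim: s c => //= d s IH c cU /andP[cd ds].
have dU : d.1 \in U by case/mapP: cd => m mD ->; exact: delta_U mD.
by rewrite dU; exact: IH ds.
Qed.

(* A walk longer than [size U] visits some vertex twice; cutting out the cycle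
   does not increase the cost. *)
Lemma walk_short s : k0 \in U -> walk start s -> exists s',
  [/\ walk start s', size s' <= size U, (last start s').1 = (last start s).1
    & cost (last start s') <= cost (last start s)].
Proof.
move=> kU; elim: {s}(size s) {-2}s (leqnn (size s)) => [|n IH] s sn ws.
  by exists [::]; case: s sn {ws}.
have [sU|sU] := leqP (size s) (size U); first by exists s.
have /(uniqPn k0)[i [j [ij js eqk]]] : ~~ uniq (map fst s).
  apply: contraL sU => /uniq_leq_size; rewrite -leqNgt size_map; apply.
  by move=> k /mapP[c cs ->]; exact: (allP (walk_U (c := start) kU ws)).
move: js eqk; rewrite size_map => js; rewrite !(nth_map start) //; last lia.
set c := nth _ _ i; set d := nth _ _ j => cd.
have tk : take i.+1 (take j.+1 s) = take i.+1 s by rewrite take_takel ?ltnS 1?ltnW.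
have sE : s = take i.+1 s ++ (drop i.+1 (take j.+1 s) ++ drop j.+1 s).
  by rewrite catA -tk !cat_take_drop.
have lc : last start (take i.+1 s) = c.
  by rewrite (last_nth start) size_takel; [rewrite /= nth_take | lia].
have ld : last c (drop i.+1 (take j.+1 s)) = d.
  rewrite -lc -last_cat -tk cat_take_drop.
  by rewrite (last_nth start) size_takel; [rewrite /= nth_take | lia].
move: ws; rewrite {1}sE /walk !cat_path lc ld => /and3P[w1 w2 w3].
(* The part after the cycle is transplanted from the second visit to the first, where the cost is no
   larger. *)
have [s' [ws' ss' ks' ls']] : exists s', [/\ walk c s',
    size s' = size (drop j.+1 s), (last c s').1 = (last start s).1
    & cost (last c s') <= cost (last start s)].
  rewrite [in last start s]sE !last_cat lc ld; apply: walk_sim => //.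
  by have := walk_cost w2; rewrite ld.
have [||s'' [ws'' ss'' ks'' ls'']] := IH (take i.+1 s ++ s').
- by rewrite size_cat ss' size_takel ?size_drop; lia.
- by rewrite /walk cat_path w1 lc.
by exists s''; rewrite ks'' last_cat lc; split=> //; apply: leq_trans ls'' _;
  rewrite last_cat lc.
Qed.

Lemma shortest_sound c : c \in shortest -> exists s, walk start s /\ last start s = c.
Proof.
rewrite /shortest; elim/last_ind: {1}U c => [|u k IH] c.
  by rewrite inE => /eqP->; exists [::].
rewrite foldl_rcons => /relax_sub[_ [/IH // | [d /IH[s [ws ls]] dc]]].
by exists (rcons s c); rewrite last_rcons /walk rcons_path ls dc andbT.
Qed.

Lemma shortest_min s : k0 \in U -> walk start s ->
  exists c, [/\ c \in shortest, c.1 = (last start s).1 & cost c <= cost (last start s)].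
Proof.
move=> kU ws; have [s' [ws' ss' ks' ls']] := walk_short kU ws.
have [e [en ke le]] := walk_min ws' (walk_U (c := start) kU ws') kU ss'.
exists e; split; rewrite ?ke //; last exact: leq_trans le ls'.
suff -> : shortest = iter (size U) relax [:: start] by [].
rewrite /shortest; elim/last_ind: {1 2}U => // r k.
by rewrite foldl_rcons size_rcons => ->.
Qed.

End ShortestWalks.

(** * The algorithm *)

Section Search.
Variable A : finType.
Local Notation letter := (letter A).
Local Notation word := (word A).

Definition letters : seq letter := enum {: A * bool}.

(** The reduced forms of all suffixes of [w], longest first, so that the head is [reduce w]. *)
Definition suffix_elements (w : word) : seq word :=
  foldr (fun x s => cons_red x (head [::] s) :: s) [:: [::]] w.

(** The base vertex is listed separately to be present even without generators. *)
Definition vertices (ws : seq word) : seq word :=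
  [::] :: flatten [seq suffix_elements w | w <- ws].

(** Reading a letter at a vertex leads to a one-letter extension, which must be comparable with the
    vertices. *)
Definition points (ws : seq word) : seq word :=
  vertices ws ++ flatten [seq [seq cons_red x p | x <- letters] | p <- vertices ws].

Definition point_pairs (ws : seq word) : seq (word * word) :=
  flatten [seq [seq (a, b) | b <- points ws] | a <- points ws].

(** The rules are reflexivity, triviality of the cosets of generators, the euclidean rule, which
    with reflexivity yields symmetry and transitivity, and invariance of left cosets under left
    multiplication by a letter. *)
Definition same_step (ws : seq word) (R : seq (word * word)) (p : word * word) :=
  (p.1 == p.2) || (p \in [seq (head [::] (suffix_elements w), [::]) | w <- ws])
  || has (fun r => ((r, p.1) \in R) && ((r, p.2) \in R)) (points ws)
  || has (fun x => (cons_red x p.1, cons_red x p.2) \in R) letters.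

(* [(a, b) \in same ws] iff a^-1 b belongs to the subgroup generated by [ws]. *)
Definition same (ws : seq word) := saturate (same_step ws) (point_pairs ws).

(* A state is a vertex together with the last letter read (which is the first
   letter of the word, as words are read from right to left); it is kept in order
   to read reduced words only. *)
Definition moves (ws : seq word) (s : word * word) (x : letter) : seq (word * word) :=
  if s.2 == [:: linv x] then [::]
  else [seq (p, [:: x]) | p <- vertices ws & (cons_red x s.1, p) \in same ws].

Definition states (ws : seq word) : seq (word * word) :=
  flatten [seq [seq (p, h) | h <- [::] :: [seq [:: x] | x <- letters]]
          | p <- vertices ws].

Local Notation key := (bool * ((word * word) * (word * word)))%type.

(* The boolean is [false] as long as the two words are read separately and
   [true] once the letters of the common prefix are being read. *)
Definition delta (I : seq word * seq word) (k : key) :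
    seq (key * (word * word * nat)) :=
  flatten [seq
    (if k.1 then [::] else
       [seq ((false, (s, k.2.2)), ([:: x], [::], 1)) | s <- moves I.1 k.2.1 x] ++
       [seq ((false, (k.2.1, s)), ([::], [:: x], 1)) | s <- moves I.2 k.2.2 x]) ++
    flatten [seq [seq ((true, (s, t)), ([:: x], [:: x], 0)) | t <- moves I.2 k.2.2 x]
            | s <- moves I.1 k.2.1 x]
  | x <- letters].

Definition keys (I : seq word * seq word) : seq key :=
  flatten [seq flatten [seq [seq (b, (s, t)) | t <- states I.2] | s <- states I.1]
          | b <- [:: false; true]].

Definition origin : key := (false, (([::], [::]), ([::], [::]))).

(** The remembered letter is empty only before anything is read, so the last conjunct excludes the
    trivial pair. *)
Definition accepting (k : key) : bool :=
  (k.2.1.1 == [::]) && (k.2.2.1 == [::]) && ~~ ((k.2.1.2 == [::]) && (k.2.2.2 == [::])).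

Definition closest (I : seq word * seq word) : seq (word * word) :=
  [seq c.2.1
  | c <- cheapest [seq c <- shortest (delta I) (keys I) origin | accepting c.1]].

(** * Correctness *)

Section Subgroup.
Variable ws : seq word.
Local Notation H := (wsubgroup ws).
Local Notation V := (vertices ws).
Local Notation P := (points ws).
Local Notation "a ~~~ b" := ((a, b) \in same ws) (at level 70).

Lemma wsubgroupM (f g : freegroup A) : H f -> H g -> H (f * g)%g.
Proof. exact: sg_mul. Qed.

Lemma wsubgroupV (f : freegroup A) : H f -> H f^-1%g.
Proof. exact: sg_inv. Qed.

Lemma welt_cat (u v : word) : welt (u ++ v) = (welt u * welt v)%g.
Proof. by apply: val_inj; rewrite /= reduce_cat_r reduce_cat_l. Qed.

Lemma welt_cons x (u : word) : welt (x :: u) = (welt [:: x] * welt u)%g.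
Proof. by rewrite -welt_cat. Qed.

Lemma welt_reduce (u : word) : welt (reduce u) = welt u.
Proof. by apply: val_inj; rewrite /= reduce_id // reduce_reduced. Qed.

Lemma welt_cons_red x (u : word) : welt (cons_red x u) = (welt [:: x] * welt u)%g.
Proof.
rewrite -welt_cons; apply: val_inj => /=.
by have := reduce_cons_red x u [::]; rewrite !cats0.
Qed.

Lemma welt_winv (u : word) : welt (winv u) = (welt u)^-1%g.
Proof.
apply: (can_inj (mulgK (welt u))); rewrite mulVg -welt_cat.
by apply: val_inj; rewrite /= reduce_winvl.
Qed.

Lemma mem_letters x : x \in letters.
Proof. by rewrite mem_enum. Qed.

Lemma head_suffix_elements w : head [::] (suffix_elements w) = reduce w.
Proof. by elim: w => //= x w ->. Qed.

Lemma vertices_points : {subset V <= P}.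
Proof. by move=> p pV; rewrite mem_cat pV. Qed.

Lemma cons_red_points x p : p \in V -> cons_red x p \in P.
Proof.
move=> pV; rewrite mem_cat; apply/orP; right.
by apply/flatten_mapP; exists p => //; apply/mapP; exists x; rewrite ?mem_letters.
Qed.

Lemma nil_vertices : [::] \in V.
Proof. by rewrite inE. Qed.

Lemma reduced_vertices p : p \in V -> reduced p.
Proof.
rewrite inE => /orP[/eqP-> // | /flatten_mapP[w _]].
elim: w p => [|x w IH] p /=; rewrite inE; first by move/eqP->.
case/orP=> [/eqP->|/IH//]; apply: cons_red_reduced.
by rewrite head_suffix_elements reduce_reduced.
Qed.

Lemma reduced_points p : p \in P -> reduced p.
Proof.
rewrite mem_cat => /orP[/reduced_vertices //|/flatten_mapP[q qV /mapP[x _ ->]]].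
exact/cons_red_reduced/reduced_vertices.
Qed.

Lemma mem_point_pairs a b : ((a, b) \in point_pairs ws) = (a \in P) && (b \in P).
Proof.
apply/flatten_mapP/andP => [[p pP /mapP[q qP [-> ->]]] // | [aP bP]].
by exists a => //; apply: map_f.
Qed.

Lemma same_points a b : a ~~~ b -> a \in P /\ b \in P.
Proof. by move/saturate_sub; rewrite mem_point_pairs => /andP. Qed.

Lemma same_sound a b : a ~~~ b -> H ((welt a)^-1 * welt b)%g.
Proof.
apply: (saturate_ind (P := fun p => H ((welt p.1)^-1 * welt p.2)%g)) => {a b}.
move=> R [a b] RH _.
case/orP=> [/orP[/orP[/eqP/= ->|/mapP[w ws_w [-> ->]]]|/hasP[r _ /andP[]]]
  |/hasP[x _]].
- by rewrite mulVg; apply: sg_one.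
- rewrite head_suffix_elements welt_reduce mulg1; apply/sg_inv/sg_gen.
  exact: map_f.
- move=> /RH ra /RH rb; have := wsubgroupM (wsubgroupV ra) rb => /=.
  by rewrite invgM invgK !mulgA mulgK.
by move/RH => /=; rewrite !welt_cons_red invgM !mulgA mulgVK.
Qed.

Lemma same_rule a b : a \in P -> b \in P -> same_step ws (same ws) (a, b) -> a ~~~ b.
Proof. by move=> aP bP; apply: saturate_closed; rewrite mem_point_pairs aP. Qed.

Lemma same_refl a : a \in P -> a ~~~ a.
Proof. by move=> aP; apply: same_rule => //; rewrite /same_step eqxx. Qed.

Lemma same_gen w : w \in ws -> reduce w \in P -> reduce w ~~~ [::].
Proof.
move=> ws_w wP; apply: (same_rule wP (vertices_points nil_vertices)).
apply/orP; left; apply/orP; left; apply/orP; right.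
by apply/mapP; exists w; rewrite ?head_suffix_elements.
Qed.

Lemma same_euclid r a b : r ~~~ a -> r ~~~ b -> a ~~~ b.
Proof.
move=> ra rb; have [rP aP] := same_points ra; have [_ bP] := same_points rb.
apply: same_rule => //; rewrite /same_step; apply/orP; left; apply/orP; right.
by apply/hasP; exists r => //=; rewrite ra.
Qed.

Lemma same_sym a b : a ~~~ b -> b ~~~ a.
Proof. by move=> ab; apply: same_euclid ab (same_refl (same_points ab).1). Qed.

Lemma same_trans b a c : a ~~~ b -> b ~~~ c -> a ~~~ c.
Proof. by move=> /same_sym; apply: same_euclid. Qed.

(** The rule for letters is applied with [linv x], which takes the new pair back to [(a, b)], as
    points are reduced. *)
Lemma same_mul x a b : a ~~~ b -> cons_red x a \in P -> cons_red x b \in P ->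
  cons_red x a ~~~ cons_red x b.
Proof.
move=> ab aP bP; apply: same_rule => //; apply/orP; right.
apply/hasP; exists (linv x); rewrite ?mem_letters //=.
have [/reduced_points ra /reduced_points rb] := same_points ab.
by rewrite -[x in cons_red x a]linvK -[x in cons_red x b]linvK !cons_redK.
Qed.

(** Paths from [p] to [q] in the Stallings graph, where each step may pass to a congruent vertex in
    place of a quotient. Unreduced words are allowed, as products and inverses produce them. *)
Fixpoint reads (p w q : word) : Prop :=
  if w is x :: w' then exists r, [/\ r \in V, reads p w' r & cons_red x r ~~~ q]
  else p ~~~ q.

Lemma reads_same p w q q' : reads p w q -> q ~~~ q' -> reads p w q'.
Proof.
case: w => [|x w] /=; first exact: same_trans.
by move=> [r [rV pr rq]] qq; exists r; split=> //; apply: same_trans qq.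
Qed.

Lemma reads_cat r p u v q : reads r u q -> reads p v r -> reads p (u ++ v) q.
Proof.
elim: u q => [|x u IH] q /=; first by move=> rq pr; apply: reads_same rq.
by move=> [s [sV rs sq]] pr; exists s; split=> //; apply: IH.
Qed.

(** Multiplying the congruence of an edge for [x] by [linv x] gives the reversed edge. *)
Lemma reads_winv p w q : p \in V -> q \in V -> reads p w q -> reads q (winv w) p.
Proof.
move=> pV; elim: w q => [|x w IH] q qV /=; first exact: same_sym.
move=> [r [rV pr rq]]; rewrite -cat1s winv_cat.
apply: reads_cat (IH r rV pr) _ => /=; exists q; split=> //.
  exact/same_refl/vertices_points.
have rE : cons_red (linv x) (cons_red x r) = r.
  by rewrite -{2}[x]linvK cons_redK // reduced_vertices.
rewrite -rE; apply: same_mul (same_sym rq) _ _; first exact: cons_red_points.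
by rewrite rE; apply: vertices_points.
Qed.

(** This is the effect of folding: reading [linv x] and then [x] returns to a congruent vertex,
    because the relation is invariant under multiplication by [x]. So a cancelling pair can be cut
    out of a path. *)
Lemma reads_reduce p w q : reads p w q -> reads p (reduce w) q.
Proof.
elim: w q => //= x w IH q [r [rV /IH pr rq]].
case: (reduce w) pr => [|y v] /=; first by move=> pr; exists r.
case: eqP => [-> | _] pr; last by exists r.
have [r' [r'V pr' r'r]] := pr; apply: reads_same pr' _.
have := same_mul (x := x) r'r.
rewrite cons_redK ?reduced_vertices // => xr; apply: same_trans (xr _ _) rq.
  exact: vertices_points.
exact: cons_red_points.
Qed.

Lemma reads_suffixes w : {subset suffix_elements w <= V} -> reads [::] w (reduce w).
Proof.
elim: w => [|x w IH] sV /=; first exact/same_refl/vertices_points/nil_vertices.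
have rV v : v \in suffix_elements w -> v \in V.
  by move=> vw; apply: sV; rewrite inE vw orbT.
exists (reduce w); split; last 1 first.
- apply/same_refl/vertices_points/sV.
  by rewrite /= head_suffix_elements inE eqxx.
- apply: rV; rewrite -head_suffix_elements.
  by case: (w) => [|y v] /=; rewrite inE eqxx.
exact: IH.
Qed.

(** A generator is read along its own suffixes, ending at a point congruent to the base vertex.
    Products and inverses come from concatenated and reversed paths, followed by cancellation. *)
Lemma reads_subgroup g : H g -> reads [::] (fgword g) [::].
Proof.
have nV := nil_vertices; have nP := vertices_points nV.
elim=> {g} [g /mapP[w ws_w ->]||g h _ Hg _ Hh|g _ Hg] /=.
- have sV : {subset suffix_elements w <= V}.
    by move=> v vw; rewrite inE; apply/orP; right; apply/flatten_mapP; exists w.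
  apply: reads_reduce; apply: reads_same (reads_suffixes sV) _.
  apply: same_gen => //; apply/vertices_points/sV.
  by rewrite -head_suffix_elements; case: (w) => [|y v] /=; rewrite inE eqxx.
- exact: same_refl.
- by apply: reads_reduce; apply: reads_cat Hg Hh.
by apply: reads_reduce; apply: reads_winv.
Qed.

Fixpoint run (w : word) (s : word * word) : Prop :=
  if w is x :: w' then exists2 s0, run w' s0 & s \in moves ws s0 x
  else s = ([::], [::]).

Lemma movesP s x s' : reflect (exists p, [/\ s' = (p, [:: x]), s.2 != [:: linv x],
  p \in V & cons_red x s.1 ~~~ p]) (s' \in moves ws s x).
Proof.
rewrite /moves; case: eqP => [s2|/eqP s2].
  by rewrite in_nil; apply: ReflectF => -[p []].
apply: (iffP mapP) => [[p]|[p [-> _ pV sp]]].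
  by rewrite mem_filter => /andP[sp pV] ->; exists p.
by exists p => //; rewrite mem_filter sp.
Qed.

Lemma mem_states p h : p \in V -> size h <= 1 -> (p, h) \in states ws.
Proof.
move=> pV h1; apply/flatten_mapP; exists p => //; apply: map_f.
case: h h1 => [|x [|//]] _; first by rewrite inE.
by rewrite inE /= map_f // mem_letters.
Qed.

(** A run keeps the coset of its vertex equal to that of the word read, and the remembered letter is
    the first one of the word, so refusing its inverse keeps the word reduced. *)
Lemma run_sound w s : run w s ->
  [/\ H ((welt s.1)^-1 * welt w)%g, reduced w, s.2 = take 1 w & s \in states ws].
Proof.
elim: w s => [|x w IH] s /=.
  by move=> ->; split=> //; rewrite /= mulVg; apply: sg_one.
case=> s0 /IH[Hs0 rw sw _] /movesP[p [-> s0x pV /same_sound Hp]] /=.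
split; rewrite ?take0 ?mem_states //.
  have := wsubgroupM (wsubgroupV Hp) Hs0.
  by rewrite invgM invgK welt_cons_red (welt_cons x w) !mulgA mulgK.
case: w rw sw {IH Hs0} => //= y w -> sw; move: s0x.
by rewrite sw take0 eqseq_cons eqxx andbT => ->.
Qed.

(** Moves absorb congruences, but the empty run stays at the base vertex itself; hence the condition
    on [w = [::]]. *)
Lemma run_reads w q : reads [::] w q -> reduced w -> q \in V ->
  (w = [::] -> q = [::]) -> run w (q, take 1 w).
Proof.
elim: w q => [|x w IH] q; first by move=> _ _ _ ->.
case=> r [rV pr rq] rw qV _ /=; rewrite take0.
case: w IH pr rw => [|y w] IH pr rw.
  (* The path may first pass from the base vertex to a congruent [r], whereas a run starts at the
     base vertex; multiplication by [x] moves this congruence behind the first letter read. *)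
  exists ([::], [::]) => //; apply/movesP; exists q; split=> //=.
  apply: same_trans rq; apply: (same_mul (x := x) (a := [::])) pr _ _.
    exact: (cons_red_points x nil_vertices).
  exact: cons_red_points.
exists (r, [:: y]).
  by have := IH r pr (path_sorted rw) rV; rewrite /= take0; apply.
apply/movesP; exists q; split=> //=.
by rewrite eqseq_cons eqxx andbT; case/andP: rw.
Qed.

Lemma run_subgroup g : H g -> run (fgword g) ([::], take 1 (fgword g)).
Proof.
move/reads_subgroup=> Rg; apply: run_reads Rg (fgword_reduced g) nil_vertices _.
by [].
Qed.

End Subgroup.

End Search.

(** * Distances as weights of walks in the product automaton *)

Section Distance.
Variable A : finType.
Local Notation letter := (letter A).
Local Notation word := (word A).

Lemma size_reduce (w : word) : size (reduce w) <= size w.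
Proof.
elim: w => //= x w IH; case: (reduce w) IH => [|y v] //= IH.
by case: eqP => _ /=; lia.
Qed.

Lemma fgdist_welt (u v : word) :
  fgdist (welt u) (welt v) = size (reduce (winv u ++ v)).
Proof. by rewrite /fgdist -welt_winv -welt_cat. Qed.

Lemma fgdist_cat_le (c u v : word) :
  fgdist (welt (c ++ u)) (welt (c ++ v)) <= size u + size v.
Proof.
have -> : fgdist (welt (c ++ u)) (welt (c ++ v)) = fgdist (welt u) (welt v).
  by rewrite /fgdist !welt_cat invgM !mulgA mulgVK.
rewrite fgdist_welt; apply: leq_trans (size_reduce _) _.
by rewrite size_cat size_rev size_map.
Qed.

(** Cancellation is possible only at the junction. The induction moves the first letter of [u],
    inverted, onto [v]; the new junction is reduced because [u] was. *)
Lemma reduced_winv_cat (u v : word) : reduced u -> reduced v ->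
  (if u is x :: _ then if v is y :: _ then x != y else true else true) ->
  reduced (winv u ++ v).
Proof.
rewrite /winv -catrevE; elim: u v => //= x u IH v xu rv uv.
apply: IH; first exact: path_sorted xu.
  by case: v rv uv => //= y v ->; rewrite andbT linvK eq_sym.
by case: u xu => //= y u /andP[].
Qed.

Lemma fgdist_split (u v : word) : reduced u -> reduced v -> exists c u' v',
  [/\ u = c ++ u', v = c ++ v' & fgdist (welt u) (welt v) = size u' + size v'].
Proof.
have base (u0 v0 : word) : reduced u0 -> reduced v0 ->
  (if u0 is x :: _ then if v0 is y :: _ then x != y else true else true) ->
  exists c u' v', [/\ u0 = c ++ u', v0 = c ++ v'
    & fgdist (welt u0) (welt v0) = size u' + size v'].
  move=> ru rv uv; exists [::], u0, v0; split=> //.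
  rewrite fgdist_welt reduce_id; last exact: reduced_winv_cat.
  by rewrite size_cat size_rev size_map.
elim: u v => [|x u IH] [|y v] ru rv; try exact: base.
have [xy|xy] := eqVneq x y; last exact: base.
move: rv; rewrite -xy => rv.
have [c [u' [v' [uE vE dE]]]] := IH v (path_sorted ru) (path_sorted rv).
exists (x :: c), u', v'; rewrite uE vE; split=> //.
rewrite -dE uE vE /fgdist (welt_cons x (c ++ u')) (welt_cons x (c ++ v')).
by rewrite invgM !mulgA mulgVK.
Qed.

Variable I : seq word * seq word.
Local Notation H := (wsubgroup I.1).
Local Notation K := (wsubgroup I.2).
Local Notation config :=
  (bool * ((word * word) * (word * word)) * (word * word * nat))%type.
Local Notation walk := (walk (delta I)).
Local Notation start := (start (letter : eqType) (origin A)).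

Lemma mem_keys b s t :
  ((b, (s, t)) \in keys I) = (s \in states I.1) && (t \in states I.2).
Proof.
apply/flatten_mapP/andP => [[b' _ /flatten_mapP[s' s'S /mapP[t' t'S [_ -> ->]]]] //|].
case=> sS tS; exists b; first by case: b.
by apply/flatten_mapP; exists s => //; apply: map_f.
Qed.

Lemma mem_delta k (m : config) : m \in delta I k -> exists x : letter,
  [\/ exists2 s, s \in moves I.1 k.2.1 x &
        k.1 = false /\ m = ((false, (s, k.2.2)), ([:: x], [::], 1)),
      exists2 t, t \in moves I.2 k.2.2 x &
        k.1 = false /\ m = ((false, (k.2.1, t)), ([::], [:: x], 1))
    | exists s t, [/\ s \in moves I.1 k.2.1 x, t \in moves I.2 k.2.2 x
        & m = ((true, (s, t)), ([:: x], [:: x], 0))]].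
Proof.
case/flatten_mapP=> x _; rewrite mem_cat => /orP[|]; exists x.
  move: a; case: (k.1) => //; rewrite mem_cat => /orP[] /mapP[s sM ->].
    by apply: Or31; exists s.
  by apply: Or32; exists s.
by case/flatten_mapP: b => s sM /mapP[t tM ->]; apply: Or33; exists s, t.
Qed.

Lemma moves_states ws s x s' : s' \in moves ws s x -> s' \in states (A := A) ws.
Proof. by case/movesP=> p [-> _ pV _]; apply: mem_states. Qed.

Lemma delta_keys k (m : config) : k \in keys I -> m \in delta I k -> m.1 \in keys I.
Proof.
case: k => b [s t]; rewrite mem_keys => /andP[sS tS] /mem_delta[x []] /=.
- by case=> s' /moves_states s'S [_ ->]; rewrite mem_keys s'S.
- by case=> t' /moves_states t'S [_ ->]; rewrite mem_keys sS.
by case=> s' [t' [/moves_states s'S /moves_states t'S ->]]; rewrite mem_keys s'S.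
Qed.

(** Here [c] is the part read jointly. It is read last, so it stands in front, and it is empty while
    the words are read separately. *)
Definition config_ok (d : config) := exists c u v,
  [/\ run I.1 (c ++ u) d.1.2.1, run I.2 (c ++ v) d.1.2.2,
      d.2 = (c ++ u, c ++ v, size u + size v) & d.1.1 || (c == [::])].

Lemma walk_ok s : walk start s -> config_ok (last start s).
Proof.
elim/last_ind: s => [|s d IH]; first by exists [::], [::], [::].
rewrite /walk rcons_path last_rcons => /andP[/IH {}IH /mapP[m + ->]].
case: (last start s) IH => [[b [s1 s2]] w] [c [u [v [/= Ru Rv -> bc]]]].
case/mem_delta=> x []/=.
- case=> s' s'M [b0 ->]; move: bc; rewrite b0 /= => /eqP c0.
  exists [::], (x :: u), v; rewrite c0 in Ru Rv *; split=> //=.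
  by exists s1.
- case=> s' s'M [b0 ->]; move: bc; rewrite b0 /= => /eqP c0.
  exists [::], u, (x :: v); rewrite c0 in Ru Rv *; split=> //=;
    last by rewrite add1n addnS.
  by exists s2.
case=> s' [t' [s'M t'M ->]]; exists (x :: c), u, v; split=> //=.
  by exists s1.
by exists s2.
Qed.

Definition reachable (d : config) := exists2 s, walk start s & last start s = d.

Lemma reachable_extend d d' : reachable d -> d' \in extend (delta I) d -> reachable d'.
Proof.
case=> s ws <- dd'; exists (rcons s d'); rewrite ?last_rcons //.
by rewrite /walk rcons_path; apply/andP.
Qed.

(** Of all interleavings one suffices: all of [u], then all of [v], then [c] jointly. *)
Lemma reachable_run c u v s t : run I.1 (c ++ u) s -> run I.2 (c ++ v) t ->
  exists b, reachable ((b, (s, t)), (c ++ u, c ++ v, size u + size v)).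
Proof.
elim: c s t => [|x c IH] s t /=; last first.
  case=> s0 /IH{}IH s0s [t0 /IH[b Rb] t0t]; exists true.
  apply: reachable_extend Rb _; apply/mapP.
  exists ((true, (s, t)), ([:: x], [:: x], 0)) => //.
  apply/flatten_mapP; exists x; rewrite ?mem_letters // mem_cat; apply/orP; right.
  by apply/flatten_mapP; exists s => //; apply: map_f.
move=> Ru Rv; exists false; elim: v t Rv => [|x v IH] t /=; last first.
  case=> t0 /IH{}IH t0t; apply: reachable_extend IH _; apply/mapP.
  exists ((false, (s, t)), ([::], [:: x], 1)); last by rewrite /= addnS.
  apply/flatten_mapP; exists x; rewrite ?mem_letters // !mem_cat.
  by apply/orP; left; apply/orP; right; apply/mapP; exists t.
move->; elim: u s Ru => [|x u IH] s /=; first by move->; exists [::].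
case=> s0 /IH{}IH s0s; apply: reachable_extend IH _; apply/mapP.
exists ((false, (s, ([::], [::]))), ([:: x], [::], 1)) => //.
apply/flatten_mapP; exists x; rewrite ?mem_letters // !mem_cat.
by apply/orP; left; apply/orP; left; apply/mapP; exists s.
Qed.

Lemma welt_eq1 (w : word) : reduced w -> welt w = 1%g -> w = [::].
Proof. by move=> rw /(congr1 (@fgword A)) /=; rewrite reduce_id. Qed.

Lemma take1_nil (w : word) : (take 1 w == [::]) = (w == [::]).
Proof. by case: w => //= x w; rewrite take0. Qed.

(** Only an inequality holds, since a walk may read common letters separately, so its joint part
    need not be the longest common prefix. *)
Lemma accepting_nontrivial (d : config) : config_ok d -> accepting d.1 ->
  nontrivial_pair H K (welt d.2.1.1) (welt d.2.1.2) /\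
  fgdist (welt d.2.1.1) (welt d.2.1.2) <= cost d.
Proof.
case: d => [[b [[p h] [q h']]] w] [c [u [v [/= Ru Rv -> _]]]].
rewrite /accepting /= => /andP[/andP[/eqP p0 /eqP q0] hh].
split; last exact: fgdist_cat_le.
have [/= Hu ru hE _] := run_sound Ru; have [/= Hv rv h'E _] := run_sound Rv.
move: hh; rewrite hE h'E !take1_nil p0 q0 in Hu Hv * => hh.
have one : welt [::] = 1%g :> freegroup A by [].
rewrite one invg1 mul1g in Hu; rewrite one invg1 mul1g in Hv.
split=> // -[/(welt_eq1 ru) u0 /(welt_eq1 rv) v0].
by move: hh; rewrite u0 v0.
Qed.

Lemma origin_keys : origin A \in keys I.
Proof. by rewrite mem_keys !mem_states ?nil_vertices. Qed.

Lemma closest_min h k : nontrivial_pair H K h k -> exists d : config,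
  [/\ d \in shortest (delta I) (keys I) (origin A), accepting d.1
    & cost d <= fgdist h k].
Proof.
case=> Hh Kk hk1.
have [c [u [v [hE kE dE]]]] := fgdist_split (fgword_reduced h) (fgword_reduced k).
have Rh := run_subgroup Hh; have Rk := run_subgroup Kk.
rewrite hE in Rh; rewrite kE in Rk.
have [b [s ws sE]] := reachable_run Rh Rk.
(* The entry found may carry another pair of words; it shares the key with the walk for [h] and [k],
   and acceptance depends on the key alone. *)
have [d [dS d1 dc]] := shortest_min delta_keys origin_keys ws.
exists d; split=> //.
  rewrite d1 sE /accepting /= !take1_nil -hE -kE; apply/negP=> /andP[/eqP h0 /eqP k0].
  by apply: hk1; split; apply: val_inj.
apply: leq_trans dc _; rewrite sE /cost /= -dE leq_eqVlt; apply/orP; left; apply/eqP.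
by congr fgdist; apply: val_inj; rewrite /= reduce_id ?fgword_reduced.
Qed.

Lemma closest_correct :
  subgroup_distance I (if closest I is p :: _ then Some p else None).
Proof.
rewrite /closest; set S := filter _ _.
have SP d : d \in S -> config_ok d /\ accepting d.1.
  rewrite mem_filter => /andP[fd /shortest_sound[s [ws sd]]]; split=> //.
  by rewrite -sd; apply: walk_ok.
case E: (cheapest S) => [|d r] /=.
  (* Without an accepting entry there is no nontrivial pair; the pairs [(h, 1)] and [(1, k)] then
     show that both subgroups are trivial. *)
  have triv h k : H h -> K k -> h = 1%g /\ k = 1%g.
    move=> Hh Kk; case: (eqVneq (h, k) (1%g, 1%g)) => [[-> ->] // | /eqP hk].
    have [|d [dS fd _]] := @closest_min h k.
      by split=> // -[h1 k1]; apply: hk; rewrite h1 k1.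
    have /cheapest_min[e] : d \in S by rewrite mem_filter fd.
    by rewrite E.
  split=> [h Hh|k Kk].
    by have [] := triv h 1%g Hh (sg_one _).
  by have [] := triv 1%g k (sg_one _) Kk.
have dS : d \in S by apply: cheapest_sub; rewrite E inE eqxx.
have [okd fd] := SP d dS; have [ntd dd] := accepting_nontrivial okd fd.
case: d okd fd ntd dd E dS => [k [[u v] n]] /= _ _ ntd dd E dS.
split=> // h' k' /closest_min[e [eS fe el]].
have /cheapest_min[f] : e \in S by rewrite mem_filter fe.
have := size_cheapest S; rewrite E; case: r E => // E _; rewrite inE => /eqP-> fe'.
by apply: leq_trans dd (leq_trans fe' el).
Qed.

End Distance.

#[local] Arguments enc : simpl never.
#[local] Arguments Defs.tsize : simpl never.

Ltac ptime_extra ::= lazymatch goal with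
  | |- ptime (fun e => addn _ _) => apply: ptime_addn
  | |- ptime (fun e => leq (S _) _) => apply: ptime_ltn
  | |- ptime (fun e => eq_op _ _) => apply: ptime_eq
  | |- ptime (fun e => in_mem _ _) => apply: ptime_mem
  end.

(** * The algorithm runs in polynomial time *)

Section Bounds.
Variables (T : eqType).
Context {cT : code T}.

Lemma esize_mem (x : T) s : x \in s -> (esize x).+1 < esize s.
Proof.
elim: s => // y s IH; rewrite inE esize_cons ltnS => /orP[/eqP->|/IH lt].
  by rewrite -addn1 leq_add // esize_gt0.
exact: leq_trans (ltnW lt) (leq_addl _ _).
Qed.

Lemma leq_esize_filter (P : pred T) s : esize (filter P s) <= esize s.
Proof.
elim: s => [|x s IH] //; rewrite [filter _ _]/= esize_cons.
by case: (P x); rewrite ?esize_cons; lia.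
Qed.

Lemma leq_esize_seq s M :
  (forall x : T, x \in s -> esize x <= M) -> esize s <= size s * M.+1 + 1.
Proof.
elim: s => [|x s IH] H; first by [].
rewrite esize_cons [size _]/= mulSn; have xM := H x (mem_head _ _).
have {}IH := IH (fun y ys => H y (mem_behead (s := x :: s) ys)).
by rewrite -addSn -addnA leq_add.
Qed.

End Bounds.

Lemma ptime_saturate E (T : eqType) {cE : code E} {cT : code T}
    (st : E -> seq T -> T -> bool) (U : E -> seq T) :
  ptime_eqType (T := T) -> ptime (fun p : E * seq T * T => st p.1.1 p.1.2 p.2) ->
  ptime U -> ptime (fun e => saturate (st e) (U e)).
Proof.
move=> pT pst pU; rewrite /saturate; have [k kP] := ptime_esize pU.
apply: (ptime_fold (F := fun e _ R => saturate_step (st e) (U e) R)); ptimes.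
  rewrite /saturate_step; ptimes; first last.
  - by apply: (ptime_app (f := U)) => //; ptimes.
  by apply: (ptime_app (f := fun p : E * seq T * T => st p.1.1 p.1.2 p.2)
    (g := fun p : E * T * seq T * T => (p.1.1.1, p.1.2, p.2))) => //; ptimes.
exists (fun n => (n + 2) ^ k); first by polyb.
move=> e s1 s2 _; apply: leq_trans (kP e).
case/lastP: s1 => [|s x]; first exact: esize_gt0.
by rewrite foldl_rcons; apply: leq_esize_filter.
Qed.

Section Cheapest.
Variables (K L : eqType).
Context (E : Type) {cE : code E} {cK : code K} {cL : code L}.
Local Notation config := (K * (seq L * seq L * nat))%type.

Lemma ptime_cheapest (f : E -> seq config) :
  ptime f -> ptime (fun e => cheapest (f e)).
Proof.
move=> pf; have [k kP] := ptime_esize pf; rewrite /cheapest /cost.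
apply: ptime_fold; ptimes.
exists (fun n => (n + 2) ^ k); first by polyb.
move=> e s1 s2 fe; apply: leq_trans (kP e); rewrite -/(cheapest s1).
have := size_cheapest s1; case Es: (cheapest s1) => [|c [|//]] _.
  exact: esize_gt0.
have /esize_mem : c \in f e.
  by rewrite fe mem_cat; apply/orP; left; apply: cheapest_sub; rewrite Es inE.
by rewrite esize_cons esize_nil addn1.
Qed.
End Cheapest.

Lemma esize_labels L {cL : code L} (u u' v v' : seq L) (n n' : nat) :
  esize (u ++ u', v ++ v', n + n') <= esize (u, v, n) + esize (u', v', n').
Proof.
pose proof (esize_cat u u'); pose proof (esize_cat v v').
by rewrite !esize_pair /= !esize_nat; lia.
Qed.

Section Shortest.
Variables (K L : eqType).
Context (E : Type) {cE : code E} {cK : code K} {cL : code L}.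
Local Notation config := (K * (seq L * seq L * nat))%type.
Variables (delta : E -> K -> seq config) (U : E -> seq K) (k0 : E -> K).

Lemma esize_extend e (c d : config) : d \in extend (delta e) c ->
  esize d.2 <= esize (delta e c.1) + esize c.2.
Proof.
case/mapP=> m /esize_mem mD ->; apply: leq_trans (esize_labels _ _ _ _ _ _) _.
have -> : (m.2.1.1, m.2.1.2, m.2.2) = m.2 by case: (m) => [? [[? ?] ?]].
have -> : (c.2.1.1, c.2.1.2, c.2.2) = c.2 by case: (c) => [? [[? ?] ?]].
rewrite leq_add2r; apply: leq_trans (ltnW (ltnW mD)).
by apply: leqW; apply: leq_addl.
Qed.

(** The rounds are as many as the vertices in [U], the table has at most [size (U e) + 1] entries,
    the 1 allowing for the initial one, and a round enlarges labels additively, by at most the size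
    of an edge list. *)
Lemma ptime_shortest : ptime_eqType (T := K) ->
  ptime (fun p : E * K => delta p.1 p.2) -> ptime U -> ptime k0 ->
  ptime (fun e => shortest (delta e) (U e) (k0 e)).
Proof.
move=> pK pD pU p0; rewrite /shortest.
apply: (ptime_fold (F := fun e _ s => relax (delta e) (U e) s)); ptimes.
- by rewrite /start; ptimes.
- rewrite /relax; ptimes; last by apply: (ptime_app (f := U)) => //; ptimes.
  apply: ptime_cheapest; ptimes; rewrite /extend; ptimes.
  by apply: (ptime_app (f := fun p : E * K => delta p.1 p.2)
    (g := fun p : E * K * seq config * K * config => (p.1.1.1.1, p.2.1))) => //; ptimes.
have [kD kDP] := ptime_esize pD; have [kU kUP] := ptime_esize pU.
have [k1 k1P] := ptime_esize p0.
pose B n := (n + (n + 2) ^ kU + (n + 2) ^ k1 + 1 + 2) ^ kD.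
(* Bound for one entry: its key, its labels and the pair node. The 10 is ample for empty labels, and
   each round adds at most [B n]. *)
pose M n := (n + 2) ^ kU + (n + 2) ^ k1 + (10 + (n + 2) ^ kU * B n) + 1.
exists (fun n => ((n + 2) ^ kU + 1) * (M n + 1) + 1); first by rewrite /M /B; polyb.
move=> e s1 s2 Ue; set n := esize e.
have keyB k : k \in U e \/ k = k0 e -> esize k <= (n + 2) ^ kU + (n + 2) ^ k1.
  case=> [/esize_mem/ltnW/ltnW kU'|->].
    exact: leq_trans (leq_trans kU' (kUP e)) (leq_addr _ _).
  exact: leq_trans (k1P e) (leq_addl _ _).
have inv s : size s <= size (U e) -> 
    let t := foldl (fun s (_ : K) => relax (delta e) (U e) s) [:: start L (k0 e)] s in
  size t <= size (U e) + 1 /\ forall c, c \in t ->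
    (c.1 \in U e \/ c.1 = k0 e) /\ esize c.2 <= 10 + size s * B n.
  elim/last_ind: s => [|s k IH] /=.
    by split=> [|c]; [lia | rewrite inE => /eqP->; split; [right | ]].
  rewrite size_rcons => su; rewrite foldl_rcons; have [|_ IHs] := IH; first lia.
  set t := foldl _ _ _ in IHs *; split.
    rewrite /relax; elim: (U e) => //= k' r IHr; rewrite size_cat.
    by have := size_cheapest [seq c <- t ++ flatten [seq extend (delta e) c | c <- t]
      | c.1 == k']; lia.
  move=> c /relax_sub[cU ct]; split; first by left.
  case: ct => [/IHs[_ cB]|[d /IHs[dk dB] /esize_extend cd]].
    by apply: leq_trans cB _; rewrite leq_add2l leq_mul2r leqnSn orbT.
  apply: leq_trans cd _; rewrite mulSn addnCA leq_add //.
  apply: leq_trans (kDP (e, d.1)) _; apply: leq_expr2.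
  by rewrite esize_pair /= addn1 -addnA ltnS leq_add2l keyB.
have sU : size (U e) <= (n + 2) ^ kU.
  by apply: leq_trans (kUP e); apply/ltnW/size_esize.
have sz1 : size s1 <= size (U e) by rewrite Ue size_cat leq_addr.
have [st ct] := inv s1 sz1.
apply: leq_trans (leq_esize_seq (M := M n) _) _.
  move=> c /ct[ck cB]; rewrite esize_pair /M addn1 ltnS leq_add ?keyB //.
  by apply: leq_trans cB _; rewrite leq_add2l leq_mul2r (leq_trans _ sU) ?orbT.
rewrite leq_add2r !addn1 leq_mul // -addn1.
by apply: leq_trans st _; rewrite leq_add2r.
Qed.

End Shortest.

Lemma leq_esize_catr X {cX : code X} (s1 s2 : seq X) : esize s2 <= esize (s1 ++ s2).
Proof. by pose proof (esize_cat s1 s2); pose proof (esize_gt0 s1); lia. Qed.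

(** * Time bounds for the search *)

Section SearchPtime.
Variable A : finType.
Local Notation letter := (letter A).
Local Notation word := (word A).
Local Notation state := (word * word)%type.
Local Notation key := (bool * (state * state))%type.

(** Chosen so that the derived codes of words and inputs are convertible to [enc_word] and
    [enc_input]. *)
#[local] Instance code_alphabet : code A := fun a => enc_nat (enum_rank a).
#[local] Instance code_letter : code letter := @code_prod A bool _ _.
#[local] Instance code_word : code word := @code_seq letter _.

#[local] Instance ptime_eq_alphabet : ptime_eqType (T := A).
Proof.
have H (p : A * A) : ((enum_rank p.1 : nat) == enum_rank p.2) = (p.1 == p.2).
  by rewrite (inj_eq val_inj) (inj_eq enum_rank_inj).
apply: (ptime_ext H).
have R : ptime (fun a : A => enum_rank a : nat) by apply: ptime_recode.
by ptimes; apply: ptime_app R _; ptimes.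
Qed.

#[local] Instance ptime_eq_letter : ptime_eqType (T := letter).
Proof. exact: ptime_eq_prod. Qed.

#[local] Instance ptime_eq_word : ptime_eqType (T := word).
Proof. exact: ptime_eq_seq. Qed.

Lemma ptime_head E {cE : code E} (f : E -> seq word) :
  ptime f -> ptime (fun e => head [::] (f e)).
Proof. by move=> pf; rewrite /head; ptimes. Qed.

Lemma ptime_linv E {cE : code E} (f : E -> letter) :
  ptime f -> ptime (fun e => linv (f e)).
Proof. by move=> pf; rewrite /linv; ptimes. Qed.

Ltac ptime_extra2 := fail.

Ltac ptime_extra ::= lazymatch goal with
  | |- ptime (fun e => addn _ _) => apply: ptime_addn
  | |- ptime (fun e => leq (S _) _) => apply: ptime_ltn
  | |- ptime (fun e => eq_op _ _) => apply: ptime_eq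
  | |- ptime (fun e => in_mem _ _) => apply: ptime_mem
  | |- ptime (fun e => head _ _) => apply: ptime_head
  | |- ptime (fun e => linv _) => apply: ptime_linv
  | _ => ptime_extra2
  end.

Lemma ptime_cons_red E {cE : code E} (f : E -> letter) (g : E -> word) :
  ptime f -> ptime g -> ptime (fun e => cons_red (f e) (g e)).
Proof.
move=> pf pg.
apply: (ptime_app (f := fun p : letter * word => cons_red p.1 p.2)
  (g := fun e => (f e, g e))); last by ptimes.
by rewrite /cons_red; ptimes.
Qed.

Lemma esize_cons_red (x : letter) (w : word) :
  esize (cons_red x w) <= esize x + esize w + 1.
Proof.
case: w => [|y w]; rewrite addn1; first exact: leqnn.
rewrite [cons_red _ _]/=; case: eqP => _; last exact: leqnn.
by rewrite leqW // (leq_trans _ (leq_addl _ _)) // ltnW // ltnS leq_addl.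
Qed.

Lemma esize_suffix_elements (w : word) :
  (forall v, v \in suffix_elements w -> esize v <= esize w)
  /\ size (suffix_elements w) = (size w).+1.
Proof.
elim: w => [|x w [IH ss]] /=; first by split=> // v; rewrite inE => /eqP->.
split; last by rewrite ss.
move=> v; rewrite inE esize_cons => /orP[/eqP->|/IH vw]; last first.
  exact: leq_trans vw (leq_trans (leq_addl _ _) (leqnSn _)).
apply: leq_trans (esize_cons_red _ _) _; rewrite addn1 ltnS leq_add2l.
by apply: IH; case: (w) => [|y u] /=; rewrite inE eqxx.
Qed.

Lemma ptime_suffix_elements E {cE : code E} (f : E -> word) :
  ptime f -> ptime (fun e => suffix_elements (f e)).
Proof.
move=> pf; apply: (ptime_app (f := @suffix_elements A)) pf => {f}.
have H (w : word) : foldl (fun s x => cons_red x (head [::] s) :: s) [:: [::]] (rev w) =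
    suffix_elements w by rewrite foldl_rev.
apply: (ptime_ext H); apply: ptime_fold; ptimes.
- by apply: ptime_rev; ptimes.
- by apply: ptime_cons_red; ptimes.
exists (fun n => n * (n + 1) + 1); first by polyb.
move=> w s1 s2 ws; rewrite -(revK s1) foldl_rev -/(suffix_elements _).
have sw : esize (rev s1) <= esize w.
  by rewrite -(revK w) ws rev_cat; apply: leq_esize_catr.
have [B S] := esize_suffix_elements (rev s1).
apply: leq_trans (leq_esize_seq (M := esize w) _) _.
  by move=> v /B vs; apply: leq_trans vs sw.
rewrite leq_add2r addn1 leq_mul // S; apply: leq_trans sw; exact: size_esize.
Qed.

Ltac ptime_extra2 ::= lazymatch goal with
  | |- ptime (fun e => cons_red _ _) => apply: ptime_cons_red
  | |- ptime (fun e => suffix_elements _) => apply: ptime_suffix_elements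
  end.

Lemma ptime_vertices E {cE : code E} (f : E -> seq word) :
  ptime f -> ptime (fun e => vertices (f e)).
Proof.
move=> pf; apply: (ptime_app (f := @vertices A)) pf => {f}.
by rewrite /vertices; ptimes.
Qed.

Lemma ptime_points E {cE : code E} (f : E -> seq word) :
  ptime f -> ptime (fun e => points (f e)).
Proof.
move=> pf; apply: (ptime_app (f := @points A)) pf => {f}.
by rewrite /points; ptimes; apply: ptime_vertices; ptimes.
Qed.

Lemma ptime_point_pairs E {cE : code E} (f : E -> seq word) :
  ptime f -> ptime (fun e => point_pairs (f e)).
Proof.
move=> pf; apply: (ptime_app (f := @point_pairs A)) pf => {f}.
by rewrite /point_pairs; ptimes; apply: ptime_points; ptimes.
Qed.

Lemma ptime_same E {cE : code E} (f : E -> seq word) :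
  ptime f -> ptime (fun e => same (f e)).
Proof.
move=> pf; apply: (ptime_app (f := @same A)) pf => {f}.
rewrite /same; apply: ptime_saturate; last by apply: ptime_point_pairs; ptimes.
by rewrite /same_step; ptimes; apply: ptime_points; ptimes.
Qed.

Lemma ptime_moves E {cE : code E}
    (f : E -> seq word) (g : E -> state) (h : E -> letter) :
  ptime f -> ptime g -> ptime h -> ptime (fun e => moves (f e) (g e) (h e)).
Proof.
move=> pf pg ph.
apply: (ptime_app (f := fun p : seq word * state * letter => moves p.1.1 p.1.2 p.2)
  (g := fun e => (f e, g e, h e))); last by ptimes.
rewrite /moves; ptimes; first by apply: ptime_same; ptimes.
by apply: ptime_vertices; ptimes.
Qed.

Lemma ptime_states E {cE : code E} (f : E -> seq word) :
  ptime f -> ptime (fun e => states (f e)).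
Proof.
move=> pf; apply: (ptime_app (f := @states A)) pf => {f}.
by rewrite /states; ptimes; apply: ptime_vertices; ptimes.
Qed.

Lemma ptime_delta : ptime (fun p : (seq word * seq word) * key => delta p.1 p.2).
Proof. by rewrite /delta; ptimes; apply: ptime_moves; ptimes. Qed.

Lemma ptime_keys : ptime (@keys A).
Proof. by rewrite /keys; ptimes; apply: ptime_states; ptimes. Qed.

Lemma ptime_closest : ptime (@closest A).
Proof.
rewrite /closest; ptimes; apply: ptime_cheapest; ptimes.
  by rewrite /accepting; ptimes.
apply: ptime_shortest; ptimes; first exact: ptime_delta.
exact: ptime_keys.
Qed.

(** The alphabet is finite and fixed, so the unary codes of its letters have bounded size. *)
Lemma esize_letter : exists C, forall x : letter, esize x <= C.
Proof.
exists (\max_(x : letter) esize x) => x.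
exact: (@leq_bigmax _ (fun x : letter => esize x)).
Qed.

(** The end marker counted for each word pays for the list nodes that even an empty word needs. *)
Lemma esize_words : exists C, forall ws : seq word,
  esize ws <= C * sumn [seq (size w).+1 | w <- ws] + 1.
Proof.
have [C CP] := esize_letter; exists C.+2.
elim=> [|w ws IH]; first by rewrite esize_nil muln0.
rewrite esize_cons [sumn _]/= mulnDr -addnA -addSn leq_add //.
have arith m : (m * C.+1 + 1).+1 <= C.+2 * m.+1 by lia.
exact: leq_trans (leq_esize_seq (s := w) (fun x _ => CP x)) (arith (size w)).
Qed.

End SearchPtime.

Theorem theorem4p1 (A : finType) :
  polytime_solvable (@enc_input A) (@enc_output A) (@input_size A)
    (@subgroup_distance A).
Proof.
pose out (s : seq (word A * word A)) := if s is p :: _ then Some p else None.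
pose cs : code (seq (word A * word A)) :=
  @code_seq _ (@code_prod _ _ (@code_word A) (@code_word A)).
(* The head of a nonempty list is the code of its pair, and [EHd] of the empty list is [Leaf], the
   code of [None]. *)
have hd : ptree (fun s => @enc _ cs s) (fun s => enc_output (out s)).
  apply: (ptree_assign (e := EHd (Var 0)) (f := fun n => n + n)); first by polyb.
  move=> s st /= ->; split; first by case: s => [|[u v] s].
  by rewrite addn0 leq_add2r; case: s => [|p s] //; rewrite esize_cons leqW ?leq_addr.
have [c [n [k [n0 H]]]] :=
  ptree_comp (f := @closest A) (fun=> erefl) (ptime_closest A) hd.
have [C CP] := esize_words A.
(* The 3 counts the pair node of the input and one leaf for each of the two lists; the 2 comes from
   the bound in [ptree]. *)
exists c, (((C%:P * 'X + 3%N%:P + 2%N%:P) ^+ k)%R) => I.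
have [t [s [ct s0 _ tk]]] := H I (init_store (enc_input I)) erefl.
exists (out (closest I)), t, s; split=> //; first exact: closest_correct.
apply: leq_trans (leq_addr _ _) (leq_trans tk _).
rewrite !hornerE natrXE; apply: leq_expr2; rewrite esize_pair.
apply: leq_ltn_trans (leq_add (CP I.1) (CP I.2)) _.
by rewrite -[X in _ < X]/(C * input_size I + 3) /input_size mulnDr; lia.
Qed.
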